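(* Let $N \ge 2$ and let $P \colon C \to P(C)$ be a map on the non-negative orthant $C \subset \mathbb{R}^N$ satisfying the standing assumptions (H1), (H2), (H3$'$), (H4$'$), (H5), (H6) listed in the context, and let $S$ be the carrying simplex for $P$. Assume that $S$ is convex, i.e. that the global attractor $\Gamma = \{\alpha x : \alpha \in [0,1],\ x \in S\}$ is a convex set. Then $S$ is a $C^1$ submanifold-with-corners neatly embedded in $C$; that is, there exists a $C^1$ function $\rho \colon \triangle \to (0,\infty)$ such that $(R|_S)^{-1}(y) = \rho(y)\, y$ for all $y \in \triangle$.
   Context: Notation. $C = \{x \in \mathbb{R}^N : x_i \ge 0 \text{ for all } i\}$, $V = \mathbb{R}^N$ (as a vector space), $K = \{v \in V : v_i \ge 0 \text{ for all } i\}$, $C^\circ = \{x \in C: x_i>0 \text{ for all } i\}$, $\partial C = C \setminus C^\circ$. For $I \subset \{1,\dots,N\}$: $C_I = \{x \in C : x_j = 0 \text{ for } j \notin I\}$, $\dot C_I = \{x \in C_I : x_i > 0 \text{ for } i \in I\}$, $\partial C_I = C_I \setminus \dot C_I$, $V_I = \{v \in V : v_j = 0 \text{ for } j \notin I\}$, $K_I = K \cap V_I$, $\dot K_I = \{v \in K_I : v_i>0 \text{ for } i \in I\}$. For $x,y \in C_I$ (or in $V_I$): $x \le_I y$ if $x_i \le y_i$ for all $i \in I$; $x <_I y$ if $x \le_I y$ and $x \ne y$; $x \ll_I y$ if $x_i < y_i$ for all $i \in I$; the subscript is dropped when $I = \{1,\dots,N\}$. A set $A \subset C$ is invariant if $P(A)=A$.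 A map $P = (P_1,\dots,P_N)\colon C \to P(C) \subset \mathbb{R}^N$ is a $C^k$ diffeomorphism onto its image if it is the restriction to $C$ of a $C^k$ diffeomorphism $\tilde P \colon U \to \tilde P(U)$, with $U \supset C$ open in $\mathbb{R}^N$. Standing assumptions on $P$: (H1) $P$ is a $C^2$ diffeomorphism onto its image $P(C)$. (H2) For each nonempty $I \subset \{1,\dots,N\}$, each of the sets $A = C_I, \dot C_I, \partial C_I$ satisfies $P(A) \subset A$ and $P^{-1}(A) \subset A$. (H3$'$) For each nonempty $I \subset \{1,\dots,N\}$ and $x \in \dot C_I$, the $I \times I$ matrix $D(P|_{C_I})(x)^{-1} = (DP(x)^{-1})_I = (DP^{-1}(Px))_I$ has all entries positive. Moreover, for any non-zero $v \in K_{\{1,\dots,N\}\setminus I}$ there exists $j \in I$ such that $(DP(x)^{-1}v)_j > 0$. (H4$'$) For each $i \in \{1,\dots,N\}$, $P|_{C_{\{i\}}}$ has a unique fixed point $u_i$ with positive $i$-th coordinate, and $0 < (d/dx_i)(P|_{C_{\{i\}}})(u_i) < 1$. Moreover, $\frac{\partial P_i}{\partial x_j}(u_i) < 0$ for $j \ne i$. (H5) If $I$ is nonempty and $x \in \dot C_I$ is a nontrivial (nonzero) $p$-periodic point of $P$, then $\mu_{I,p}(x) < 1$, where $\mu_{I,p}(x)$ is the (necessarily real) eigenvalue of $D(P|_{C_I})^p(x)$ with the smallest modulus. (H6) For each nonempty $I \subset \{1,\dots,N\}$ and $x,y \in \dot C_I$, if $0 \ll_I Px \ll_I Py$, then $\frac{P_i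 x}{P_i y} \ge \frac{x_i}{y_i}$ for all $i \in I$. Let $\triangle = \{x \in C : \sum_i x_i = 1\}$ and let $R\colon C\setminus\{0\} \to \triangle$, $R(x) = x/\sum_i x_i$, be the radial projection. It is known that under these assumptions there is a compact invariant set $S \subset C$, the carrying simplex for $P$, such that: (i) $R|_S \colon S \to \triangle$ is a homeomorphism; (ii) no two points of $S$ are related by $\ll$, and for each nonempty $I$ no two points of $S \cap \dot C_I$ are related by $<_I$; (iii) for each $x \in C \setminus \{0\}$ the $\omega$-limit set of $x$ is contained in $S$; (iv) the global attractor $\Gamma$ of $P$ (the compact invariant set $\Gamma\subset C$ such that for every bounded $B \subset C$ and every $\epsilon>0$, $P^n(B)$ lies in the $\epsilon$-neighbourhood of $\Gamma$ for all sufficiently large $n$) equals $\{\alpha x : \alpha \in [0,1],\ x \in S\}$. ''$C^1$ on $\triangle$'' means $C^1$ up to the boundary of the simplex. The statement that $S$ is a $C^1$ submanifold-with-corners neatly embedded in $C$ is understood exactly as the existence of a $C^1$ function $\rho$ as in the claim. *)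

(* Defs.v *)
From mathcomp Require Import all_boot all_order all_algebra.
From mathcomp Require Import all_classical all_reals all_analysis.
From mathcomp Require Import complex.

Set Implicit Arguments.
Unset Strict Implicit.
Unset Printing Implicit Defensive.

Import Order.TTheory GRing.Theory Num.Theory.
Import numFieldNormedType.Exports.

Local Open Scope classical_set_scope.
Local Open Scope ring_scope.

(* Points of R^N are row vectors.  The norm on 'rV[R]_N is the sup norm; only
   its topology and its bounded sets matter here. *)

Section Smoothness.
Variable R : realType.

(* f is C^k on the open set U; 'D_v f is the directional derivative.  On a
   finite-dimensional V, testing every direction v amounts to continuity of the
   full derivative. *)
Fixpoint Ck_on (V W : normedModType R) (k : nat) (U : set V) (f : V -> W) :
    Prop :=
  if k is k'.+1 then
    (forall x, U x -> differentiable f x) /\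
    (forall v, Ck_on k' U (fun x => 'D_v f x))
  else forall x, U x -> {for x, continuous f}.

(* C^k on a set A that need not be open: f is the restriction to A of a C^k
   function defined on an open neighbourhood of A. *)
Definition Ck_up_to_boundary (V W : normedModType R) (k : nat) (A : set V)
    (f : V -> W) : Prop :=
  exists (U : set V) (g : V -> W),
    [/\ open U, A `<=` U, Ck_on k U g & {in A, f =1 g}].

Variable N : nat.
Implicit Types (f : 'rV[R]_N -> 'rV[R]_N) (U A : set 'rV[R]_N).

(* f is a C^k diffeomorphism from the open set U onto the open set f(U). *)
Definition Ck_diffeo (k : nat) U f : Prop :=
  [/\ open U, open (f @` U), Ck_on k U f &
      exists g : 'rV[R]_N -> 'rV[R]_N,
        Ck_on k (f @` U) g /\ {in U, cancel f g}].

(* P is a C^k diffeomorphism of A onto P(A), as witnessed by the extension Pt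
   of P to the open set U.  The values of P outside A are irrelevant. *)
Definition Ck_diffeo_extension (k : nat) A (P : 'rV[R]_N -> 'rV[R]_N) U
    (Pt : 'rV[R]_N -> 'rV[R]_N) : Prop :=
  [/\ A `<=` U, Ck_diffeo k U Pt & {in A, P =1 Pt}].

(* The matrix with (i, j) entry d f_i / d x_j; the transpose is there because
   [jacobian] acts on row vectors from the right. *)
Definition Dmx f (x : 'rV[R]_N) : 'M[R]_N := (jacobian f x)^T.

(* The I x I submatrix of M. *)
Definition principal_submx (I : {set 'I_N}) (M : 'M[R]_N) : 'M[R]_#|I| :=
  mxsub (@enum_val _ (mem I)) (@enum_val _ (mem I)) M.

End Smoothness.

Section Orthant.
Variables (R : realType) (N : nat).
Implicit Types (I : {set 'I_N}) (x y : 'rV[R]_N) (S : set 'rV[R]_N).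

(* The cone K in V = R^N is the same set as C, and K_I the same set as C_I. *)
Definition orthant : set 'rV[R]_N := [set x | forall i, 0 <= x 0 i].

Definition face I : set 'rV[R]_N :=
  [set x | orthant x /\ forall j, j \notin I -> x 0 j = 0].

Definition face_int I : set 'rV[R]_N :=
  [set x | face I x /\ forall i, i \in I -> 0 < x 0 i].

Definition face_bd I : set 'rV[R]_N := face I `\` face_int I.

Definition le_on I x y : Prop := forall i, i \in I -> x 0 i <= y 0 i.
Definition lt_on I x y : Prop := le_on I x y /\ x <> y.
Definition ll_on I x y : Prop := forall i, i \in I -> x 0 i < y 0 i.

Definition simplex : set 'rV[R]_N :=
  [set x | orthant x /\ \sum_i x 0 i = 1].

Definition radial x : 'rV[R]_N := (\sum_i x 0 i)^-1 *: x.

Definition radial_hull S : set 'rV[R]_N :=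
  [set z | exists a x, [/\ 0 <= a, a <= 1, S x & z = a *: x]].

End Orthant.

Arguments orthant {R N}.
Arguments simplex {R N}.
Arguments face {R N} I.
Arguments face_int {R N} I.
Arguments face_bd {R N} I.

Section Dynamics.
Variables (R : realType) (N : nat).
Implicit Types (P : 'rV[R]_N -> 'rV[R]_N) (x : 'rV[R]_N) (A S G : set 'rV[R]_N).

Definition invariant P A : Prop := P @` A = A.

Definition omega_limit P x : set 'rV[R]_N :=
  cluster ((fun n => iter n P x) @ \oo).

Definition global_attractor P G : Prop :=
  [/\ compact G, G `<=` orthant, invariant P G &
      forall B, bounded_set B -> B `<=` orthant ->
      forall e : R, 0 < e ->
      exists n0, forall n, (n0 <= n)%N ->
        iter n P @` B `<=` \bigcup_(g in G) ball g e].

Definition homeomorphism_between (f : 'rV[R]_N -> 'rV[R]_N) A B : Prop :=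
  [/\ set_bij A B f, {within A, continuous f} &
      exists g : 'rV[R]_N -> 'rV[R]_N,
        {within B, continuous g} /\ {in A, cancel f g}].

Record carrying_simplex P S : Prop := CarryingSimplex {
  cs_compact : compact S;
  cs_sub : S `<=` orthant `\ 0;
  cs_invariant : invariant P S;
  cs_homeo : homeomorphism_between (@radial R N) S simplex;
  cs_unordered : forall x y, S x -> S y -> ~ ll_on [set: 'I_N]%SET x y;
  cs_unordered_face : forall I : {set 'I_N}, I != finset.set0 ->
    forall x y, S x -> face_int I x -> S y -> face_int I y -> ~ lt_on I x y;
  cs_omega : forall x, orthant x -> x != 0 -> omega_limit P x `<=` S;
  cs_attractor : global_attractor P (radial_hull S)
}.

End Dynamics.

(* In the conditions below P is the map on the orthant C and Pt a smooth
   extension of it to a neighbourhood of C.  Derivatives of P on C are those of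
   Pt; since C is the closure of its interior they do not depend on Pt. *)
Section Hypotheses.
Variables (R : realType) (N : nat).
Variables (P Pt : 'rV[R]_N -> 'rV[R]_N).

Definition faces_preserved : Prop :=
  forall I : {set 'I_N}, I != finset.set0 ->
  forall A : set 'rV[R]_N, A = face I \/ A = face_int I \/ A = face_bd I ->
    P @` A `<=` A /\ orthant `&` P @^-1` A `<=` A.

Definition inverse_positive : Prop :=
  forall I : {set 'I_N}, I != finset.set0 ->
  forall x, face_int I x ->
    (forall i j, i \in I -> j \in I -> 0 < invmx (Dmx Pt x) i j) /\
    (forall v : 'rV[R]_N, face (~: I)%SET v -> v != 0 ->
       exists2 j, j \in I & 0 < (invmx (Dmx Pt x) *m v^T) j 0).

(* On the one-dimensional face C_{i}, the derivative of the restriction of P is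
   d P_i / d x_i. *)
Definition axial_fixed_points : Prop :=
  forall i : 'I_N, exists u : 'rV[R]_N,
    [/\ face [set i]%SET u /\ 0 < u 0 i,
        P u = u,
        forall w, face [set i]%SET w -> 0 < w 0 i -> P w = w -> w = u,
        0 < Dmx Pt u i i < 1 &
        forall j, j != i -> Dmx Pt u i j < 0].

(* z is a complex eigenvalue of the real matrix M, of smallest modulus. *)
Definition smallest_eigenvalue n (M : 'M[R]_n) (z : R[i]) : Prop :=
  let MC := map_mx (fun a : R => a%:C%C) M in
  eigenvalue MC z /\ forall w : R[i], eigenvalue MC w -> `|z| <= `|w|.

(* In the order of R[i], z < 1 means that z is real and smaller than 1.  The
   matrix of D(P|_{C_I})^p(x) is the I x I submatrix of D(P^p)(x). *)
Definition periodic_eigenvalue_lt1 : Prop :=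
  forall I : {set 'I_N}, I != finset.set0 ->
  forall (x : 'rV[R]_N) (p : nat),
    face_int I x -> x != 0 -> (0 < p)%N -> iter p P x = x ->
  forall z : R[i],
    smallest_eigenvalue (principal_submx I (Dmx (iter p Pt) x)) z -> z < 1.

Definition ratio_condition : Prop :=
  forall I : {set 'I_N}, I != finset.set0 ->
  forall x y, face_int I x -> face_int I y ->
    ll_on I 0 (P x) -> ll_on I (P x) (P y) ->
  forall i, i \in I -> P x 0 i / P y 0 i >= x 0 i / y 0 i.

End Hypotheses.

(* Main.v *)
(** Let G = {a x : 0 <= a <= 1, x in S}, a convex set, and let g be the inverse
    of P.  Since G is convex and invariant, n |-> n Dg(x) sends the normal
    functionals of G at g(x) to those of G at x.  By (H3') the matrices Dg(x) are
    nonnegative, and a product of two consecutive ones has a strictly positive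
    row, whose index lies in the support of the point.  Nonnegative normals,
    normalised by <n, x> = 1, are bounded, because G contains a point of each
    positive half-axis.  Hence the cocycle satisfies a Doeblin condition, uniformly
    up to the boundary of S: the ratios of two positive vectors are averaged with
    a common weight, so that their oscillation decays exponentially.  Pushing
    forward the constant vector (1, ..., 1) along backward orbits therefore
    converges uniformly on S, to a continuous field nu of normals of G.
    For the gauge p of G, with nu extended to be constant on rays, convexity gives
    0 <= p z - p x - <nu x, z - x> <= <nu z - nu x, z - x>,
    so p is C^1 in the sense of Whitney on the orthant minus the origin.
    Successive odd reflections in the coordinate hyperplanes extend it to a C^1
    function beyond the boundary, and rho = 1 / p. *)

From HB Require Import structures.
Require Import Defs.
From mathcomp Require Import all_boot all_order all_algebra.
From mathcomp Require Import all_classical all_reals all_analysis.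
From mathcomp Require Import ring lra.
Import Order.TTheory GRing.Theory Num.Theory.
Import numFieldNormedType.Exports.
Local Open Scope classical_set_scope.
Local Open Scope ring_scope.

Set Implicit Arguments.
Unset Strict Implicit.
Unset Printing Implicit Defensive.

(** * The Euclidean pairing on row vectors *)

Section Dot.
Variables (R : realType) (N : nat).
Implicit Types (u v w x : 'rV[R]_N).

Definition dot u v : R := \sum_i u 0 i * v 0 i.

Lemma dotC u v : dot u v = dot v u.
Proof. by apply: eq_bigr => i _; rewrite mulrC. Qed.

Lemma dotDr u v w : dot u (v + w) = dot u v + dot u w.
Proof. by rewrite -big_split; apply: eq_bigr => i _; rewrite mxE mulrDr. Qed.

Lemma dotZr a u v : dot u (a *: v) = a * dot u v.
Proof. by rewrite big_distrr; apply: eq_bigr => i _; rewrite mxE mulrCA. Qed.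

Lemma dotNr u v : dot u (- v) = - dot u v.
Proof. by rewrite -scaleN1r dotZr mulN1r. Qed.

Lemma dotBr u v w : dot u (v - w) = dot u v - dot u w.
Proof. by rewrite dotDr dotNr. Qed.

Lemma dotDl u v w : dot (u + v) w = dot u w + dot v w.
Proof. by rewrite dotC dotDr !(dotC w). Qed.

Lemma dotZl a u v : dot (a *: u) v = a * dot u v.
Proof. by rewrite dotC dotZr dotC. Qed.

Lemma dotNl u v : dot (- u) v = - dot u v.
Proof. by rewrite dotC dotNr dotC. Qed.

Lemma dotBl u v w : dot (u - v) w = dot u w - dot v w.
Proof. by rewrite dotDl dotNl. Qed.

Lemma dot_mulmx u v (M : 'M[R]_N) : dot (u *m M) v = dot u (v *m M^T).
Proof.
rewrite /dot.
under eq_bigr do rewrite mxE big_distrl /=.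
rewrite exchange_big /=; apply: eq_bigr => i _.
rewrite mxE big_distrr /=; apply: eq_bigr => j _.
by rewrite mxE -mulrA; congr (_ * _); rewrite mulrC.
Qed.

Lemma dot_ge0 u v : (forall i, 0 <= u 0 i) -> (forall i, 0 <= v 0 i) ->
  0 <= dot u v.
Proof. by move=> u0 v0; apply: sumr_ge0 => i _; rewrite mulr_ge0. Qed.

Lemma coord_le_norm m (M : 'M[R]_(m, N)) i j : `|M i j| <= `|M|.
Proof.
rewrite [leRHS]/Num.Def.normr/= mx_normrE.
by apply/bigmax_geP; right => /=; exists (i, j).
Qed.

Lemma norm_le_coord u e : 0 <= e -> (forall i, `|u 0 i| <= e) -> `|u| <= e.
Proof.
move=> e0 ue; rewrite [leLHS]/Num.Def.normr/= mx_normrE (bigmax_le _ e0)//=.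
by move=> -[i j] _; rewrite ord1.
Qed.

Lemma norm_dot_le u v : `|dot u v| <= N%:R * (`|u| * `|v|).
Proof.
apply: le_trans (ler_norm_sum _ _ _) _.
rewrite -[X in X%:R](card_ord N) mulr_natl -sumr_const; apply: ler_sum => i _.
by rewrite normrM ler_pM// coord_le_norm.
Qed.

Lemma rV_cvg (T : Type) (F : set_system T) {FF : Filter F}
    (f : T -> 'rV[R]_N) (l : 'rV[R]_N) :
  (forall i, (fun t => f t 0 i) @ F --> l 0 i) -> f @ F --> l.
Proof.
move=> fl; apply/cvgrPdist_le => e e0.
have : \forall t \near F, forall i, `|l 0 i - f t 0 i| <= e.
  apply: filter_forall => i.
  by have /cvgrPdist_le := fl i; apply.
apply: filterS => t H; apply: norm_le_coord; first exact: ltW.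
by move=> i; rewrite !mxE.
Qed.

Lemma coord_cvg (T : Type) (F : set_system T) {FF : Filter F}
    (f : T -> 'rV[R]_N) (l : 'rV[R]_N) i :
  f @ F --> l -> (fun t => f t 0 i) @ F --> l 0 i.
Proof.
move=> /cvgrPdist_le fl; apply/cvgrPdist_le => e /fl; apply: filterS => t.
by apply: le_trans; have := coord_le_norm (l - f t) 0 i; rewrite !mxE.
Qed.

Lemma cvg_dot (T : Type) (F : set_system T) {FF : Filter F}
    (f g : T -> 'rV[R]_N) (a b : 'rV[R]_N) :
  f @ F --> a -> g @ F --> b -> (fun t => dot (f t) (g t)) @ F --> dot a b.
Proof.
move=> fa gb; apply: cvg_big => [|i _]; first exact: add_continuous.
by apply: cvgM; exact: coord_cvg.
Qed.

Lemma cvg_mulmx (T : Type) (F : set_system T) {FF : Filter F}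
    (f : T -> 'rV[R]_N) (M : T -> 'M[R]_N) (a : 'rV[R]_N) (L : 'M[R]_N) :
  f @ F --> a -> (forall i j, (fun t => M t i j) @ F --> L i j) ->
  (fun t => f t *m M t) @ F --> a *m L.
Proof.
move=> fa ML; apply: rV_cvg => j; rewrite mxE.
under eq_fun do rewrite mxE.
apply: cvg_big => [|i _]; first exact: add_continuous.
by apply: cvgM; [exact: coord_cvg|exact: ML].
Qed.

End Dot.

(** * Extension of C^1 functions across the faces of the orthant *)

Section ReflectionExtension.
Variables (R : realType) (N : nat).
Implicit Types (u v x z : 'rV[R]_N) (A B : set 'rV[R]_N).
Implicit Types (f : 'rV[R]_N -> R) (nu : 'rV[R]_N -> 'rV[R]_N).

(* A pointwise form of the Whitney condition; on an open set it says that f is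
   C^1 with gradient nu. *)
Definition c1_within A f nu : Prop :=
  forall x, A x -> forall e, 0 < e -> exists2 d, 0 < d &
    forall z, A z -> `|z - x| < d ->
      `|f z - f x - dot (nu x) (z - x)| <= e * `|z - x| /\
      `|nu z - nu x| <= e.

Lemma eq_c1_within A f f' nu nu' : (forall x, A x -> f x = f' x) ->
  (forall x, A x -> nu x = nu' x) -> c1_within A f nu -> c1_within A f' nu'.
Proof.
move=> ff' nn' fA x Ax e e0; have [d d0 H] := fA x Ax e e0.
by exists d => // z Az zx; rewrite -!ff'// -!nn'//; exact: H.
Qed.

(** Off the hyperplane [x 0 i = 0] a small ball stays on one side. On it both estimates hold for the
    same values [f x] and [nu x], so the smaller radius serves every [z]. *)
Lemma c1_within_glue i A f nu :
  c1_within (A `&` [set x | 0 <= x 0 i]) f nu ->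
  c1_within (A `&` [set x | x 0 i <= 0]) f nu -> c1_within A f nu.
Proof.
move=> fp fn x Ax e e0.
have dist z : `|z 0 i - x 0 i| <= `|z - x|.
  by have := coord_le_norm (z - x) 0 i; rewrite !mxE.
have [xi0|xi0|xi0] := ltgtP 0 (x 0 i).
- have [|d d0 H] := fp x _ e e0; first by split=> //=; exact: ltW.
  exists (Num.min d (x 0 i)); first by rewrite lt_min d0.
  move=> z Az; rewrite lt_min => /andP[zd zx]; apply: H => //; split=> //=.
  have := le_lt_trans (dist z) zx; rewrite ltr_norml => /andP[]; lra.
- have [|d d0 H] := fn x _ e e0; first by split=> //=; exact: ltW.
  exists (Num.min d (- x 0 i)); first by rewrite lt_min d0 oppr_gt0.
  move=> z Az; rewrite lt_min => /andP[zd zx]; apply: H => //; split=> //=.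
  have := le_lt_trans (dist z) zx; rewrite ltr_norml => /andP[]; lra.
- have [|d d0 H] := fp x _ e e0; first by split=> //=; rewrite -xi0.
  have [|d' d'0 H'] := fn x _ e e0; first by split=> //=; rewrite -xi0.
  exists (Num.min d d'); first by rewrite lt_min d0.
  move=> z Az; rewrite lt_min => /andP[zd zd'].
  have [zi|zi] := leP 0 (z 0 i); first exact: H.
  by apply: H' => //; split=> //=; exact: ltW.
Qed.

Definition flat i x : 'rV[R]_N := \row_j (if j == i then 0 else x 0 j).
Definition flip i x : 'rV[R]_N := \row_j (if j == i then - x 0 j else x 0 j).

Lemma flatB i x z : flat i (x - z) = flat i x - flat i z.
Proof. by apply/rowP => j; rewrite !mxE; case: ifP; rewrite ?subr0. Qed.

Lemma flipB i x z : flip i (x - z) = flip i x - flip i z.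
Proof. by apply/rowP => j; rewrite !mxE; case: ifP => //; rewrite opprD. Qed.

Lemma norm_flat i x : `|flat i x| <= `|x|.
Proof.
apply: norm_le_coord => // j; rewrite mxE; case: ifP => _.
  by rewrite normr0.
exact: coord_le_norm.
Qed.

Lemma norm_flip i x : `|flip i x| <= `|x|.
Proof.
apply: norm_le_coord => // j; rewrite mxE; case: ifP => _; rewrite ?normrN;
exact: coord_le_norm.
Qed.

Lemma dot_flat i u v : dot (flat i u) v = dot u (flat i v).
Proof.
by apply: eq_bigr => j _; rewrite !mxE; case: ifP; rewrite ?mul0r ?mulr0.
Qed.

Lemma dot_flip i u v : dot (flip i u) v = dot u (flip i v).
Proof.
by apply: eq_bigr => j _; rewrite !mxE; case: ifP; rewrite ?mulNr ?mulrN.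
Qed.

(** The reason for the weights 2 and -1: on the hyperplane the reflected gradient reduces to [nu x],
    so the gradients of the two sides agree there. *)
Lemma flat_flip i x : 2 *: flat i x - flip i x = x.
Proof. by apply/rowP => j; rewrite !mxE; case: eqP => _; lra. Qed.

Lemma flat_id i x : x 0 i = 0 -> flat i x = x.
Proof. by move=> x0; apply/rowP => j; rewrite !mxE; case: eqP => [->|]. Qed.

Lemma flip_id i x : x 0 i = 0 -> flip i x = x.
Proof.
by move=> x0; apply/rowP => j; rewrite !mxE; case: eqP => // ->; rewrite x0 oppr0.
Qed.

(** A chain rule: [flat i] and [flip i] are linear, self-adjoint for [dot], and do not increase the
    sup norm. *)
Lemma c1_within_odd i A f nu : c1_within A f nu ->
  c1_within [set x | A (flat i x) /\ A (flip i x)]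
    (fun x => 2 * f (flat i x) - f (flip i x))
    (fun x => 2 *: flat i (nu (flat i x)) - flip i (nu (flip i x))).
Proof.
move=> fA x [Ax Ax'] e e0.
(* The weights 2 and 1 of the two terms add up to 3. *)
have e30 : 0 < e / 3 by rewrite divr_gt0.
have [d d0 H] := fA _ Ax _ e30.
have [d' d'0 H'] := fA _ Ax' _ e30.
exists (Num.min d d'); first by rewrite lt_min d0.
move=> z [Az Az']; rewrite lt_min => /andP[zd zd'].
have [|h1 h2] := H _ Az.
  by rewrite -flatB; exact: le_lt_trans (norm_flat _ _) zd.
have [|h1' h2'] := H' _ Az'.
  by rewrite -flipB; exact: le_lt_trans (norm_flip _ _) zd'.
rewrite -flatB in h1; rewrite -flipB in h1'.
split.
- have -> : dot (2 *: flat i (nu (flat i x)) - flip i (nu (flip i x))) (z - x) =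
    2 * dot (nu (flat i x)) (flat i (z - x)) -
    dot (nu (flip i x)) (flip i (z - x)).
    by rewrite dotBl dotZl dot_flat dot_flip.
  have := le_trans h1 (ler_wpM2l (ltW e30) (norm_flat i (z - x))).
  have := le_trans h1' (ler_wpM2l (ltW e30) (norm_flip i (z - x))).
  rewrite !ler_norml; lra.
- have -> : 2 *: flat i (nu (flat i z)) - flip i (nu (flip i z)) -
      (2 *: flat i (nu (flat i x)) - flip i (nu (flip i x))) =
    2 *: flat i (nu (flat i z) - nu (flat i x)) -
    flip i (nu (flip i z) - nu (flip i x)).
    rewrite flatB flipB; apply/rowP => j; rewrite !mxE; lra.
  apply: le_trans (ler_normB _ _) _; rewrite normrZ ger0_norm//.
  have := le_trans (norm_flat i _) h2.
  have := le_trans (norm_flip i _) h2'.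
  lra.
Qed.

(** Beyond the hyperplane this is the reflection of [f] that is odd about its value at the foot
    [flat i x]. *)
Definition odd_ext i f x : R :=
  if 0 <= x 0 i then f x else 2 * f (flat i x) - f (flip i x).
Definition odd_ext_grad i nu x : 'rV[R]_N :=
  if 0 <= x 0 i then nu x
  else 2 *: flat i (nu (flat i x)) - flip i (nu (flip i x)).

Lemma c1_within_odd_ext i A B f nu :
  B `&` [set x | 0 <= x 0 i] `<=` A ->
  B `&` [set x | x 0 i <= 0] `<=` [set x | A (flat i x) /\ A (flip i x)] ->
  c1_within A f nu -> c1_within B (odd_ext i f) (odd_ext_grad i nu).
Proof.
move=> BA BA' fA; apply: (@c1_within_glue i).
- apply: (@eq_c1_within _ f _ nu).
  + by move=> x [_ /= xi]; rewrite /odd_ext xi.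
  + by move=> x [_ /= xi]; rewrite /odd_ext_grad xi.
  move=> x /BA Ax e e0; have [d d0 H] := fA x Ax e e0.
  by exists d => // z /BA Az; exact: H.
- apply: (eq_c1_within (f := fun x => 2 * f (flat i x) - f (flip i x))
    (nu := fun x => 2 *: flat i (nu (flat i x)) - flip i (nu (flip i x)))).
  + move=> x [_ /= xi]; rewrite /odd_ext; case: ifP => // xi'.
    have x0 : x 0 i = 0 by apply/eqP; rewrite eq_le xi.
    by rewrite flat_id// flip_id//; lra.
  + move=> x [_ /= xi]; rewrite /odd_ext_grad; case: ifP => // xi'.
    have x0 : x 0 i = 0 by apply/eqP; rewrite eq_le xi.
    by rewrite (flat_id x0) (flip_id x0) flat_flip.
  have fA' := @c1_within_odd i _ _ _ fA.
  move=> x /BA' Ax e e0; have [d d0 H] := fA' x Ax e e0.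
  by exists d => // z /BA' Az; exact: H.
Qed.

(* The orthant minus the origin for k = 0, the complement of the closed
   negative orthant for k = N. *)
Definition partial_orthant (k : nat) : set 'rV[R]_N :=
  [set x | (exists i, 0 < x 0 i) /\
           forall i : 'I_N, (k <= i)%N -> 0 <= x 0 i].

(** Induction on [k]: a reflection in the hyperplane of coordinate [k] removes the sign condition on
    that coordinate. *)
Lemma c1_within_extension f nu : c1_within (partial_orthant 0) f nu ->
  exists g mu, c1_within (partial_orthant N) g mu /\
    forall x, partial_orthant 0 x -> g x = f x.
Proof.
move=> f0.
suff H k : (k <= N)%N -> exists g mu, c1_within (partial_orthant k) g mu /\
    forall x, partial_orthant 0 x -> g x = f x by exact: H.
elim: k => [_|k IH kN]; first by exists f, nu.
have [g [mu [gk gf]]] := IH (ltnW kN).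
pose i := Ordinal kN.
have kP x : partial_orthant k.+1 x -> 0 <= x 0 i -> partial_orthant k x.
  move=> [xp xk] xi; split=> // j; rewrite leq_eqVlt => /orP[/eqP kj|]; last exact: xk.
  by have -> : j = i by exact/val_inj/esym.
exists (odd_ext i g), (odd_ext_grad i mu); split.
- apply: c1_within_odd_ext gk => [x [xk xi]|x [[[j xj] xk] /= xi]]; first exact: kP.
  (* The positive coordinate differs from [i], so it survives in both [flat i x] and [flip i x];
     these points therefore avoid the excluded closed negative orthant. *)
  have ji : j != i by apply: contraTneq xj => ->; rewrite -leNgt.
  split; (split; first by exists j; rewrite mxE (negPf ji)).
    move=> l kl; rewrite mxE; case: eqP => // /eqP li; apply: xk.
    by rewrite ltn_neqAle kl andbT eq_sym.
  move=> l kl; rewrite mxE; case: eqP => [->|/eqP li]; first by rewrite oppr_ge0.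
  by apply: xk; rewrite ltn_neqAle kl andbT eq_sym.
- by move=> x x0; rewrite /odd_ext x0.2// gf.
Qed.

End ReflectionExtension.

(** * From the pointwise Whitney condition to C^1 functions on open sets *)

Lemma diff_of_linear_approx (R : realType) (V W : normedModType R) (f : V -> W)
    (L : {linear V -> W}) x :
  continuous L ->
  (forall e : R, 0 < e ->
     \forall h \near (0 : V), `|f (h + x) - f x - L h| <= e * `|h|) ->
  differentiable f x /\ 'd f x = L :> (V -> W).
Proof.
move=> cL H.
have fo : f \o shift x = cst (f x) + L +o_ 0 id.
  apply/eqaddoP => e e0; apply: filterS (H e e0) => h.
  by rewrite !fctE /shift /= opprD addrA.
have dfx := diff_unique cL fo.
by split=> //; apply/diff_locallyP; rewrite dfx.
Qed.

Section GradientDifferentiable.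
Variables (R : realType) (N : nat).
Implicit Types (u v x z : 'rV[R]_N) (A : set 'rV[R]_N).
Implicit Types (f : 'rV[R]_N -> R) (nu : 'rV[R]_N -> 'rV[R]_N).

Lemma dot_linear u : linear (dot u).
Proof. by move=> a v w; rewrite dotDr dotZr. Qed.

Lemma dot_continuous u : continuous (dot u).
Proof.
move=> x.
exact: (@cvg_dot _ _ _ (nbhs x) _ (fun=> u) id u x (cvg_cst _) cvg_id).
Qed.

Lemma c1_within_diff A f nu x : open A -> c1_within A f nu -> A x ->
  differentiable f x /\ forall v, 'D_v f x = dot (nu x) v.
Proof.
move=> oA fA Ax.
pose M := GRing.isLinear.Build _ _ _ _ _ (dot_linear (nu x)).
pose L : {linear 'rV[R]_N -> R} := HB.pack (dot (nu x)) M.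
have cL : continuous L by exact: dot_continuous.
have [|df dfx] := diff_of_linear_approx (f := f) (x := x) cL.
  move=> e e0; have [d d0 H] := fA x Ax e e0.
  have /nbhs_ballP[r /= r0 rA] := open_nbhs_nbhs (conj oA Ax).
  apply/nbhs_ballP; exists (Num.min d r); first by rewrite /= lt_min d0.
  move=> h; rewrite -ball_normE /= sub0r normrN lt_min => /andP[hd hr].
  have Ahx : A (h + x).
    by apply: rA; rewrite -ball_normE /= opprD addrCA subrr addr0 normrN.
  by have := (H _ Ahx); rewrite addrK => /(_ hd)[].
by split=> // v; rewrite deriveE// dfx.
Qed.

Lemma c1_within_Ck_on A f nu : open A -> c1_within A f nu -> Ck_on 1 A f.
Proof.
move=> oA fA; split; first by move=> x Ax; have [] := c1_within_diff oA fA Ax.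
move=> v x Ax.
suff : 'D_v f z @[z --> x] --> 'D_v f x by [].
rewrite (proj2 (c1_within_diff oA fA Ax)).
have : (fun z => dot (nu z) v) z @[z --> x] --> dot (nu x) v.
  apply: (@cvg_dot _ _ _ (nbhs x) _ nu (fun=> v)); last exact: cvg_cst.
  apply/cvgrPdist_le => e e0.
  have [d d0 H] := fA x Ax e e0.
  have /nbhs_ballP[r /= r0 rA] := open_nbhs_nbhs (conj oA Ax).
  apply/nbhs_ballP; exists (Num.min d r); first by rewrite /= lt_min d0.
  move=> z; rewrite -ball_normE /= lt_min => /andP[zd zr].
  have Az : A z by apply: rA; rewrite -ball_normE.
  by rewrite distrC in zd; have [_] := H _ Az zd; rewrite distrC.
apply: cvg_trans; apply: (@near_eq_cvg _ _ (nbhs x)).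
apply: filterS (open_nbhs_nbhs (conj oA Ax)) => z Az /=.
by rewrite (proj2 (c1_within_diff oA fA Az)).
Qed.

Lemma Ck_on1_inv A f : open A -> (forall x, A x -> f x != 0) -> Ck_on 1 A f ->
  Ck_on 1 A (fun x => (f x)^-1).
Proof.
move=> oA f0 [df cdf]; split.
  by move=> x Ax; apply: differentiableV; [exact: df|exact: f0].
move=> v x Ax.
have DV z : A z -> 'D_v (fun x => (f x)^-1) z = - (f z) ^- 2 *: 'D_v f z.
  by move=> Az; rewrite deriveV ?f0//; apply: diff_derivable; exact: df.
suff : 'D_v (fun x => (f x)^-1) z @[z --> x] --> 'D_v (fun x => (f x)^-1) x by [].
rewrite DV//.
have : (fun z => - (f z) ^- 2 *: 'D_v f z) z @[z --> x] --> - (f x) ^- 2 *: 'D_v f x.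
  have cf : f z @[z --> x] --> f x by apply: differentiable_continuous; exact: df.
  apply: (@cvgZ _ _ _ (nbhs x)); last exact: cdf.
  have : (f z ^+ 2)^-1 @[z --> x] --> (f x ^+ 2)^-1.
    apply: (@cvgV _ _ (nbhs x) _ (fun z => f z ^+ 2)).
      by rewrite expf_neq0// f0.
    rewrite expr2; under eq_fun do rewrite expr2.
    exact: (@cvgM _ _ (nbhs x) _ f f _ _ cf cf).
  exact: (@cvgN _ _ _ (nbhs x)).
apply: cvg_trans; apply: (@near_eq_cvg _ _ (nbhs x)).
by apply: filterS (open_nbhs_nbhs (conj oA Ax)) => z Az; rewrite DV.
Qed.

End GradientDifferentiable.

(** * Relative continuity and uniform bounds on compact sets *)

Section ContinuousOn.

(** Subspace continuity in filter form (see [cont_on_within]), to which the limit rules for sums and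
    products apply directly. *)
Definition cont_on (T U : topologicalType) (S : set T) (f : T -> U) : Prop :=
  forall x, S x -> f @ within S (nbhs x) --> f x.

Lemma cont_on_comp (T U V : topologicalType) (S : set T) (S' : set U)
    (f : T -> U) (g : U -> V) :
  (forall x, S x -> S' (f x)) -> cont_on S f -> cont_on S' g ->
  cont_on S (g \o f).
Proof.
move=> fS cf cg x Sx A /(cg _ (fS _ Sx)) /(cf _ Sx).
by rewrite !nbhs_simpl /within /=; apply: filterS => y H Sy; apply: H => //; exact: fS.
Qed.

Lemma cont_on_within (T U : topologicalType) (S : set T) (f : T -> U) :
  {within S, continuous f} <-> cont_on S f.
Proof. exact: subspace_continuousP. Qed.

Lemma continuous_cont_on (T U : topologicalType) (S : set T) (f : T -> U) x :
  {for x, continuous f} -> f @ within S (nbhs x) --> f x.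
Proof. by move=> cf; apply: cvg_within_filter. Qed.

Lemma cont_on_bounded_above (R : realType) (T : topologicalType) (S : set T)
    (f : T -> R) : compact S -> cont_on S f ->
  exists2 L, 0 < L & forall x, S x -> f x <= L.
Proof.
move=> cS /cont_on_within cf.
have [->|S0] := eqVneq S set0; first by exists 1.
have [c cin H] := compact_EVT_max (proj1 (set0P S) S0) cS cf.
exists (`|f c| + 1); first by rewrite ltr_wpDl.
move=> x Sx; have := H x (mem_set Sx); have := ler_norm (f c); lra.
Qed.

Lemma cont_on_bounded_below (R : realType) (T : topologicalType) (S : set T)
    (f : T -> R) : compact S -> cont_on S f -> (forall x, S x -> 0 < f x) ->
  exists2 L, 0 < L & forall x, S x -> L <= f x.
Proof.
move=> cS /cont_on_within cf f0.
have [->|S0] := eqVneq S set0; first by exists 1.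
have [c cin H] := compact_EVT_min (proj1 (set0P S) S0) cS cf.
exists (f c) => [|x Sx]; last exact: H (mem_set Sx).
exact/f0/set_mem.
Qed.

Lemma finite_uniform_pos (R : realType) (T : finType) (Q : T -> R -> Prop) :
  (forall t, exists2 k, 0 < k & Q t k) ->
  (forall t k k', k' <= k -> Q t k -> Q t k') ->
  exists2 k, 0 < k & forall t, Q t k.
Proof.
move=> Qex Qle.
have /choice[f fP] : forall t, exists k, 0 < k /\ Q t k.
  by move=> t; have [k k0 Qk] := Qex t; exists k.
exists (\big[Num.min/1]_t f t).
  by elim/big_ind : _ => // [a b a0 b0|t _]; [rewrite lt_min a0|have [] := fP t].
move=> t; apply: Qle (fP t).2; rewrite (bigD1 t)//=.
by rewrite ge_min lexx.
Qed.

End ContinuousOn.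

(** * Limits of sequences with geometrically small increments *)

Section GeometricLimit.
Variables (R : realType) (N : nat).

Lemma geometric_limit (u : nat -> 'rV[R]_N) (K theta : R) :
  0 <= theta < 1 -> (forall k, `|u k.+1 - u k| <= K * theta ^+ k) ->
  exists l : 'rV[R]_N, u @ \oo --> l /\
    forall k, `|l - u k| <= K * theta ^+ k / (1 - theta).
Proof.
move=> /andP[th0 th1] uK.
have K0 : 0 <= K by have := le_trans (normr_ge0 _) (uK 0%N); rewrite expr0 mulr1.
have d0 : 0 < 1 - theta by rewrite subr_gt0.
have B m k : `|u (k + m)%N - u k| <= K * theta ^+ k / (1 - theta).
  (* With the factor [1 - theta ^+ m] the bound is the exact partial geometric sum, so the induction
     closes with an equality. *)
  suff : `|u (k + m)%N - u k| <= K * theta ^+ k / (1 - theta) * (1 - theta ^+ m).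
    move=> /le_trans; apply; rewrite ler_piMr//.
      by rewrite divr_ge0 ?mulr_ge0 ?exprn_ge0// ltW.
    by rewrite gerBl exprn_ge0.
  elim: m => [|m IH].
    by rewrite addn0 subrr normr0 expr0 subrr mulr0.
  rewrite addnS -[X in `|X|](subrKA (u (k + m)%N)).
  apply: le_trans (ler_normD _ _) _.
  apply: le_trans (lerD (uK _) IH) _.
  rewrite exprD exprS; set a := theta ^+ k; set b := theta ^+ m.
  rewrite le_eqVlt; apply/orP; left; apply/eqP; field.
  exact: lt0r_neq0.
have cu : cvg (u @ \oo).
  apply/cauchy_cvgP/cauchy_exP => e e0.
  have [k Hk] : exists k, K * theta ^+ k / (1 - theta) < e.
    have : (fun k => K / (1 - theta) * theta ^+ k) @ \oo --> (0 : R).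
      by apply: cvg_geometric; rewrite ger0_norm.
    move=> /cvgrPdist_lt /(_ _ e0) [k _ /(_ k (leqnn k))] /=.
    rewrite sub0r normrN mulrAC ger0_norm; first by exists k.
    by rewrite divr_ge0 ?mulr_ge0 ?exprn_ge0// ltW.
  exists (u k); exists k => // n /= kn; rewrite -ball_normE /= distrC.
  by rewrite -(subnKC kn); exact: le_lt_trans (B _ _) Hk.
exists (lim (u @ \oo)); split => // k.
have : (fun n => `|u n - u k|) @ \oo --> `|lim (u @ \oo) - u k|.
  by apply: cvg_norm; apply: cvgB => //; exact: cvg_cst.
move/cvgr_to_le; apply.
by exists k => // n /= kn; rewrite -(subnKC kn).
Qed.

End GeometricLimit.

(** * Contraction of positive cocycles *)

Section DoeblinContraction.
Variables (R : realType) (N : nat).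
Implicit Types (n s : 'rV[R]_N) (M : 'M[R]_N).

(** The largest summand is at least the average. *)
Lemma exists_large_summand (a : 'I_N -> R) : 0 < \sum_i a i ->
  exists i, \sum_i a i <= N%:R * a i.
Proof.
move=> a0; apply: contrapT => /forallNP H.
have {}H i : N%:R * a i < \sum_i a i by rewrite ltNge; exact/negP.
have [N0|N0] := posnP N.
  have a00 : \sum_i a i = 0.
    by apply: big1 => -[i iN]; exfalso; move: iN; rewrite [X in (_ < X)%N]N0.
  by rewrite a00 ltxx in a0.
have e : \sum_i N%:R * a i = \sum_(i < N) \sum_i a i.
  by rewrite -big_distrr /= sumr_const card_ord mulr_natl.
suff : \sum_i N%:R * a i < \sum_(i < N) \sum_i a i by rewrite e ltxx.
by apply: ltr_sum => //; apply/hasP; exists (Ordinal N0).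
Qed.

Lemma le_mulmx_coord M s i j : (forall k l, 0 <= M k l) ->
  (forall k, 0 <= s 0 k) -> s 0 i * M i j <= (s *m M) 0 j.
Proof.
move=> M0 s0; rewrite mxE (bigD1 i)//= lerDl sumr_ge0// => k _.
by rewrite mulr_ge0.
Qed.

(* The ratios s'_j / n'_j are averages of the ratios s_k / n_k, and all these
   averages give weight at least del to the same index i. *)
Lemma doeblin_step M n s i (del a b : R) :
  0 < del <= 1 -> a <= b -> (forall k j, 0 <= M k j) -> (forall k, 0 <= n 0 k) ->
  (forall j, del * (n *m M) 0 j <= n 0 i * M i j) ->
  (forall k, a * n 0 k <= s 0 k <= b * n 0 k) ->
  exists a' b', [/\ a <= a', a' <= b', b' <= b,
    b' - a' = (1 - del) * (b - a) &
    forall j, a' * (n *m M) 0 j <= (s *m M) 0 j <= b' * (n *m M) 0 j].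
Proof.
move=> /andP[del0 del1] ab M0 n0 di sn.
(* [r] is the ratio at the index [i]. If [n 0 i = 0], the bounds force [s 0 i = 0] and any value in
   [[a, b]] would do. *)
have [r [ar rb sr]] : exists r, [/\ a <= r, r <= b & s 0 i = r * n 0 i].
  have [ni0|ni0] := eqVneq (n 0 i) 0.
    exists a; split => //; have := sn i; rewrite ni0 !mulr0 => /andP[h1 h2].
    by apply/eqP; rewrite eq_le h1 h2.
  have nip : 0 < n 0 i by rewrite lt_neqAle eq_sym ni0 n0.
  exists (s 0 i / n 0 i); have /andP[h1 h2] := sn i.
  by rewrite ler_pdivlMr// ler_pdivrMr// h1 h2 divfK.
have eqd : b - del * (b - r) - (a + del * (r - a)) = (1 - del) * (b - a) by ring.
(* Each endpoint moves towards [r] by the fraction [del] of its distance; in total the interval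
   loses [del * (b - a)]. *)
exists (a + del * (r - a)), (b - del * (b - r)); split=> //.
- by rewrite lerDl mulr_ge0 ?subr_ge0// ltW.
- by rewrite -subr_ge0 eqd mulr_ge0 ?subr_ge0.
- by rewrite gerBl mulr_ge0 ?subr_ge0// ltW.
move=> j.
(* Keep only the [i]-th term in the product of the nonnegative vector [s - a *: n] with [M]; [hi]
   does the same for [b *: n - s]. *)
have lo : (r - a) * (n 0 i * M i j) <= (s *m M) 0 j - a * (n *m M) 0 j.
  have := @le_mulmx_coord M (s - a *: n) i j M0.
  rewrite mulmxBl -scalemxAl !mxE sr -mulrBl -mulrA; apply=> k.
  by rewrite !mxE subr_ge0; have /andP[] := sn k.
have hi : (b - r) * (n 0 i * M i j) <= b * (n *m M) 0 j - (s *m M) 0 j.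
  have := @le_mulmx_coord M (b *: n - s) i j M0.
  rewrite mulmxBl -scalemxAl !mxE sr -mulrBl -mulrA; apply=> k.
  by rewrite !mxE subr_ge0; have /andP[] := sn k.
have h1 : (r - a) * (del * (n *m M) 0 j) <= (r - a) * (n 0 i * M i j).
  by rewrite ler_wpM2l ?subr_ge0.
have h2 : (b - r) * (del * (n *m M) 0 j) <= (b - r) * (n 0 i * M i j).
  by rewrite ler_wpM2l ?subr_ge0.
apply/andP; split; lra.
Qed.

End DoeblinContraction.

Section PositiveNormals.
Variables (R : realType) (N : nat).
Implicit Types (n s x z : 'rV[R]_N) (M : 'M[R]_N) (G S : set 'rV[R]_N).

Definition pos_normal G x n : Prop :=
  (forall i, 0 <= n 0 i) /\ forall z, G z -> dot n z <= dot n x.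

Lemma pos_normalZ G x n a : 0 <= a -> pos_normal G x n ->
  pos_normal G x (a *: n).
Proof.
move=> a0 [n0 nG]; split=> [i|z Gz]; first by rewrite mxE mulr_ge0.
by rewrite !dotZl ler_wpM2l// nG.
Qed.

Lemma pos_normal_cvg G x (u : nat -> 'rV[R]_N) n :
  (forall k, pos_normal G x (u k)) -> u @ \oo --> n -> pos_normal G x n.
Proof.
move=> uG un; split=> [i|z Gz].
  have : (u k) 0 i @[k --> \oo] --> n 0 i by exact: coord_cvg.
  move/cvgr_to_ge; apply.
  by apply: nearW => k; have [] := uG k.
rewrite -subr_ge0 -dotBr.
have : dot (u k) (x - z) @[k --> \oo] --> dot n (x - z).
  by apply: cvg_dot => //; exact: cvg_cst.
move/cvgr_to_ge; apply; apply: nearW => k; rewrite dotBr subr_ge0.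
by have [_] := uG k; exact.
Qed.

End PositiveNormals.

(** * A continuous section of normals for a positive cocycle *)

Section PositiveCocycle.
Variables (R : realType) (N : nat) (S G : set 'rV[R]_N).
Variables (h : 'rV[R]_N -> 'rV[R]_N) (W : 'rV[R]_N -> 'M[R]_N) (B : R).
Hypotheses (S_compact : compact S) (S_ge0 : forall x, S x -> forall i, 0 <= x 0 i).
Hypotheses (h_S : forall x, S x -> S (h x)) (h_cont : cont_on S h).
Hypothesis W_cont : forall i j, cont_on S (fun x => W x i j).
Hypothesis W_ge0 : forall x, S x -> forall i j, 0 <= W x i j.
Hypothesis W_gt0 : forall x, S x -> forall i j, 0 < h x 0 i -> 0 < W x i j.
Hypothesis W_normal : forall x n, S x -> pos_normal G (h x) n ->
  pos_normal G x (n *m W x).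
Hypothesis B_gt0 : 0 < B.
Hypothesis normal_le : forall x n, S x -> pos_normal G x n ->
  forall i, n 0 i <= B * dot n x.
Hypothesis normal_ex : forall x, S x ->
  exists2 n, pos_normal G x n & 0 < dot n x.

Lemma coord_bound : exists2 Y, 0 < Y & forall x, S x -> forall i, x 0 i <= Y.
Proof.
have [|Y Y0 H] := @cont_on_bounded_above R _ S (fun x => `|x|) S_compact.
  by move=> x Sx; apply: continuous_cont_on; exact: norm_continuous.
exists Y => // x Sx i; apply: le_trans (H x Sx).
exact: le_trans (ler_norm _) (coord_le_norm _ _ _).
Qed.

Lemma weight_bound : exists2 L, 0 < L & forall x, S x -> forall i j, W x i j <= L.
Proof.
have [|L L0 H] :=
  @cont_on_bounded_above R _ S (fun x => \sum_i \sum_j W x i j) S_compact.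
  move=> x Sx; apply: cvg_big => [|i _]; first exact: add_continuous.
  apply: cvg_big => [|j _]; first exact: add_continuous.
  exact: W_cont.
exists L => // x Sx i j; apply: le_trans (H x Sx).
rewrite (bigD1 i)//= (bigD1 j)//= -addrA lerDl addr_ge0 ?sumr_ge0// => k _.
  exact: W_ge0.
by rewrite sumr_ge0// => l _; exact: W_ge0.
Qed.

(** Entries of [W] may vanish at the boundary of [S], but the maximum of [W x i j] and
    [eta - h x 0 i] is continuous and positive on the compact set [S]; where [eta <= h x 0 i] it
    equals [W x i j]. *)
Lemma weight_lower_bound eta : 0 < eta ->
  exists2 k, 0 < k & forall x, S x -> forall i j, eta <= h x 0 i -> k <= W x i j.
Proof.
move=> eta0.
have [||k k0 H] := @finite_uniform_pos R ('I_N * 'I_N)%type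
  (fun ij k => forall x, S x -> eta <= h x 0 ij.1 -> k <= W x ij.1 ij.2).
- move=> [i j] /=.
  (* Twice the maximum of [W x i j] and [eta - h x 0 i], whence the bound [L / 2] below. *)
  pose f x := W x i j + (eta - h x 0 i) + `|W x i j - (eta - h x 0 i)|.
  have [||L L0 H] := @cont_on_bounded_below R _ S f S_compact.
  + have ch x : S x -> eta - h z 0 i @[z --> within S (nbhs x)] --> eta - h x 0 i.
      move=> Sx; apply: cvgB; first exact: cvg_cst.
      by apply: coord_cvg; exact: h_cont.
    move=> x Sx; apply: cvgD.
      by apply: cvgD; [exact: W_cont|exact: ch].
    by apply: cvg_norm; apply: cvgB; [exact: W_cont|exact: ch].
  + move=> x Sx; rewrite /f.
    have W0 := W_ge0 Sx i j.
    have [hi|hi] := ltP 0 (h x 0 i).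
      have := W_gt0 Sx j hi; have := ler_norm (W x i j - (eta - h x 0 i)).
      by lra.
    by have := normr_ge0 (W x i j - (eta - h x 0 i)); lra.
  exists (L / 2); first by rewrite divr_gt0.
  move=> x Sx hx; have := H x Sx; rewrite /f ger0_norm; have := W_ge0 Sx i j; lra.
- by move=> t k k' kk Q x Sx e; exact: le_trans kk (Q x Sx e).
by exists k => // x Sx i j hx; exact: (H (i, j)).
Qed.

(** Let [i] carry a large summand of [d = dot n (h x)]. As [n 0 i <= B * d], the coordinate
    [h x 0 i] is at least [1 / (N B)], so row [i] of [W x] is bounded below. As [h x 0 i <= Y], also
    [n 0 i] is at least [d / (N Y)]. Hence row [i] alone contributes at least [c * d] to each
    coordinate, while the whole coordinate is at most [D * d]. *)
Lemma uniform_doeblin : exists del c : R, [/\ 0 < del < 1, 0 < c &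
  forall x n, S x -> pos_normal G (h x) n -> 0 < dot n (h x) ->
    (exists i, forall j, del * (n *m W x) 0 j <= n 0 i * W x i j) /\
    (forall j, c * dot n (h x) <= (n *m W x) 0 j)].
Proof.
have [Y Y0 HY] := coord_bound.
have [L L0 HL] := weight_bound.
have [N0|N0] := posnP N.
  exists (1/2), 1; split => // [|x n Sx nn]; first by apply/andP; split; lra.
  rewrite /dot big1 ?ltxx// => -[i iN] _; exfalso.
  by move: iN; rewrite [X in (_ < X)%N]N0.
have NR0 : 0 < N%:R :> R by rewrite ltr0n.
have eta0 : 0 < (N%:R * B)^-1 by rewrite invr_gt0 mulr_gt0.
have [k k0 Hk] := weight_lower_bound eta0.
pose c := k / (N%:R * Y).
have c0 : 0 < c by rewrite divr_gt0// mulr_gt0.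
pose D := N%:R * (B * L).
have D0 : 0 < D by rewrite !mulr_gt0.
(* The minimum with 1/2 keeps the weight below 1. *)
exists (Num.min (1/2) (c / D)), c; split=> //.
  have h1 : 0 < 1/2 :> R by lra.
  have h2 : 1/2 < 1 :> R by lra.
  by rewrite lt_min h1 divr_gt0// gt_min h2.
move=> x n Sx nn; set d := dot n (h x) => d0.
have [n0 _] := nn.
have [i] := exists_large_summand d0; rewrite -/(dot n (h x)) -/d => di.
have ni : n 0 i <= B * d by exact: normal_le (h_S Sx) nn i.
have yi0 : 0 <= h x 0 i := S_ge0 (h_S Sx) i.
have eta_i : (N%:R * B)^-1 <= h x 0 i.
  rewrite -(ler_pM2l (mulr_gt0 NR0 B_gt0)) mulfV ?mulf_neq0 ?gt_eqF//.
  rewrite -(ler_pM2r d0) mul1r [leRHS](_ : _ = N%:R * (B * d * h x 0 i)); last by ring.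
  by apply: le_trans di _; rewrite ler_wpM2l ?(ltW NR0)// ler_wpM2r.
have lo j : c * d <= n 0 i * W x i j.
  have h1 : d <= N%:R * Y * n 0 i.
    apply: le_trans di _; rewrite -mulrA ler_wpM2l ?(ltW NR0)// mulrC ler_wpM2r//.
    exact: HY (h_S Sx) i.
  rewrite /c -mulrA [_^-1 * _]mulrC mulrA ler_pdivrMr ?mulr_gt0//.
  have h2 := Hk x Sx i j eta_i.
  apply: le_trans (ler_wpM2l (ltW k0) h1) _.
  rewrite [leLHS](_ : _ = N%:R * Y * n 0 i * k); last by ring.
  rewrite [leRHS](_ : _ = N%:R * Y * n 0 i * W x i j); last by ring.
  by rewrite ler_wpM2l// !mulr_ge0// ltW.
split; last first.
  by move=> j; apply: le_trans (lo j) (le_mulmx_coord _ _ (W_ge0 Sx) n0).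
exists i => j; apply: le_trans (lo j).
have up : (n *m W x) 0 j <= D * d.
  rewrite mxE /D -mulrA mulr_natl -[X in _ *+ X](card_ord N) -sumr_const.
  apply: ler_sum => l _; rewrite [leRHS](_ : _ = B * d * L); last by ring.
  by apply: ler_pM; [exact: n0|exact: W_ge0|exact: normal_le (h_S Sx) nn l|exact: HL].
have m0 : 0 <= Num.min (1/2) (c/D).
  by rewrite le_min; apply/andP; split; apply: divr_ge0 => //; exact: ltW.
apply: le_trans (ler_wpM2l m0 up) _.
have : Num.min (1/2) (c/D) <= c/D by rewrite ge_min lexx orbT.
move=> /(ler_wpM2r (mulr_ge0 (ltW D0) (ltW d0))) /le_trans; apply.
by rewrite mulrA divfK ?gt_eqF.
Qed.

(** Transport of the field [s] along the [h]-orbit of [x]: the matrix at [x] acts last, so that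
    normals at the [k]-th iterate become normals at [x]. *)
Fixpoint push (s : 'rV[R]_N -> 'rV[R]_N) k x : 'rV[R]_N :=
  if k is k'.+1 then push s k' (h x) *m W x else s x.

(** Turns the comparison of consecutive iterates of one field into a comparison of two fields
    transported equally far. *)
Lemma push_shift s k x : push (push s 1) k x = push s k.+1 x.
Proof. by elim: k x => [|k IH] x //=; rewrite IH. Qed.

Lemma push_cont s k : cont_on S s -> cont_on S (push s k).
Proof.
move=> cs; elim: k => [|k IH] //= x Sx; apply: cvg_mulmx; last first.
  by move=> i j; exact: W_cont.
exact: (cont_on_comp h_S h_cont IH).
Qed.

Definition unit_at x n : 'rV[R]_N := (dot n x)^-1 *: n.

Lemma dot_unit_at x n : 0 < dot n x -> dot (unit_at x n) x = 1.
Proof. by move=> d0; rewrite dotZl mulVf// gt_eqF. Qed.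

(** Since [x] is nonnegative, [dot q x / dot p x] also lies in [[a, b]]. The difference of the
    normalised coordinates is thus at most [(b - a) * p 0 j / dot q x], where [p 0 j <= B * dot p x]
    and [dot q x >= a0 * dot p x]. *)
Lemma unit_at_close (x p q : 'rV[R]_N) (a b a0 : R) :
  S x -> pos_normal G x p -> 0 < dot p x ->
  0 < a0 -> a0 <= a -> a <= b -> (forall j, a * p 0 j <= q 0 j <= b * p 0 j) ->
  `|unit_at x q - unit_at x p| <= (b - a) * (B / a0).
Proof.
move=> Sx np P0 a00 a0a ab pq; have [p0 _] := np.
set P := dot p x in P0 *.
have a_gt0 := lt_le_trans a00 a0a.
have /andP[aQ Qb] : a * P <= dot q x <= b * P.
  apply/andP; split; rewrite -subr_ge0 /P -dotZl -dotBl;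
    apply: dot_ge0 (S_ge0 Sx) => j; rewrite !mxE subr_ge0;
    by have /andP[] := pq j.
have Q0 : 0 < dot q x by apply: lt_le_trans aQ; rewrite mulr_gt0.
set Q := dot q x in aQ Qb Q0 *.
apply: norm_le_coord => [|j].
  by rewrite mulr_ge0 ?subr_ge0// divr_ge0// ltW.
rewrite !mxE -/P -/Q.
have -> : Q^-1 * q 0 j - P^-1 * p 0 j = (q 0 j * P - p 0 j * Q) / (P * Q).
  by field; rewrite !gt_eqF.
rewrite normrM normfV (ger0_norm (ltW (mulr_gt0 P0 Q0))) ler_pdivrMr ?mulr_gt0//.
have /andP[q1 q2] := pq j.
have pj := p0 j.
have up : `|q 0 j * P - p 0 j * Q| <= (b - a) * (p 0 j * P).
  have h1 := ler_wpM2r (ltW P0) q1; have h2 := ler_wpM2r (ltW P0) q2.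
  have h3 := ler_wpM2l pj aQ; have h4 := ler_wpM2l pj Qb.
  by rewrite ler_norml; apply/andP; split; lra.
apply: le_trans up _; rewrite -mulrA ler_wpM2l ?subr_ge0//.
rewrite [leRHS](_ : _ = B * P * Q / a0); last by ring.
rewrite ler_pdivlMr// -[leLHS]mulrA; apply: ler_pM => //.
- by rewrite mulr_ge0// ltW.
- exact: normal_le Sx np j.
- by rewrite mulrC; apply: le_trans aQ; rewrite ler_wpM2r// ltW.
Qed.

(** Two fields are transported: the constant one stays continuous, and [n0], built from an arbitrary
    choice of normals, stays normal. The contraction brings them together uniformly, so the common
    limit is both continuous and normal. *)
Theorem continuous_normal_section : exists nu : 'rV[R]_N -> 'rV[R]_N,
  cont_on S nu /\ forall x, S x -> pos_normal G x (nu x) /\ dot (nu x) x = 1.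
Proof.
have [L L0 HL] := weight_bound.
have [del [c [/andP[del0 del1] c0 Hdel]]] := uniform_doeblin.
have th : 0 <= 1 - del < 1 by apply/andP; split; lra.
have pos_push x n : S x -> pos_normal G (h x) n -> 0 < dot n (h x) ->
    pos_normal G x (n *m W x) /\ 0 < dot (n *m W x) x.
  move=> Sx nn d0; have nn' := W_normal Sx nn; split=> //.
  have [i _] := exists_large_summand d0.
  have [_ /(_ i) ci] := Hdel x n Sx nn d0.
  have := lt_le_trans (mulr_gt0 c0 d0) (le_trans ci (normal_le Sx nn' i)).
  by rewrite pmulr_rgt0.
have /choice[m Hm] : forall x, exists n, S x -> pos_normal G x n /\ dot n x = 1.
  move=> x; have [Sx|nSx] := pselect (S x); last by exists 0.
  have [n nn d0] := normal_ex Sx; exists (unit_at x n) => _.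
  by split; [apply: pos_normalZ => //; rewrite invr_ge0 ltW|exact: dot_unit_at].
(* One application of [W] pushes all coordinates of the chosen normal above [c], which makes [n0]
   comparable with constant fields. *)
pose n0 x := m (h x) *m W x.
have n0P x : S x -> pos_normal G x (n0 x) /\ 0 < dot (n0 x) x.
  move=> Sx; have [nn d1] := Hm _ (h_S Sx).
  by apply: pos_push => //; rewrite d1.
have n0c x : S x -> forall j, c <= n0 x 0 j.
  move=> Sx j; have [nn d1] := Hm _ (h_S Sx).
  have [|_ /(_ j)] := Hdel x _ Sx nn; first by rewrite d1.
  by rewrite d1 mulr1.
(* The summand 1 keeps [D] positive even for [N = 0]. *)
pose D := N%:R * (B * L) + 1.
have D0 : 0 < D by rewrite ltr_wpDl// !mulr_ge0// ltW.
have n0D x : S x -> forall j, n0 x 0 j <= D.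
  move=> Sx j; have [nn d1] := Hm _ (h_S Sx); have [nn0 _] := nn.
  apply: (@le_trans _ _ (N%:R * (B * L))); last by rewrite /D; lra.
  rewrite mxE mulr_natl -[X in _ *+ X](card_ord N) -sumr_const.
  apply: ler_sum => l _; apply: ler_pM; rewrite ?nn0 ?W_ge0 ?HL//.
  by have := normal_le (h_S Sx) nn l; rewrite d1 mulr1.
have pushP k x : S x -> pos_normal G x (push n0 k x) /\ 0 < dot (push n0 k x) x.
  elim: k x => [|k IH] x Sx /=; first exact: n0P.
  by have [nn d0] := IH _ (h_S Sx); exact: pos_push.
have close (s : 'rV[R]_N -> 'rV[R]_N) (lo hi : R) : 0 < lo -> lo <= hi ->
    (forall x, S x -> forall j, lo <= s x 0 j <= hi) ->
  exists K, forall k x, S x ->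
    `|unit_at x (push s k x) - unit_at x (push n0 k x)| <= K * (1 - del) ^+ k /\
    0 < dot (push s k x) x.
  move=> lo0 lohi sP; pose a0 := lo / D; pose b0 := hi / c.
  have hi0 := lt_le_trans lo0 lohi.
  have a00 : 0 < a0 by rewrite divr_gt0.
  (* The ratios start in [[lo / D, hi / c]]. The intervals are nested, so [a0] remains a lower
     bound, and each step shrinks them by [1 - del]. *)
  have ratio k x : S x -> exists a b,
      [/\ a0 <= a, a <= b, b - a <= (1 - del) ^+ k * `|b0 - a0| &
        forall j, a * push n0 k x 0 j <= push s k x 0 j <= b * push n0 k x 0 j].
    elim: k x => [|k IH] x Sx /=.
      have bnd j : a0 * n0 x 0 j <= s x 0 j <= b0 * n0 x 0 j.
        have /andP[s1 s2] := sP x Sx j.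
        rewrite /a0 /b0 !(mulrAC _ _^-1) ler_pdivrMr// ler_pdivlMr//.
        apply/andP; split; apply: ler_pM; rewrite ?(ltW lo0) ?(ltW c0) ?n0c ?n0D//.
          exact: le_trans (ltW c0) (n0c x Sx j).
        exact: le_trans (ltW lo0) s1.
      have [i _] := exists_large_summand (n0P x Sx).2.
      exists a0, b0; rewrite expr0 mul1r; split => //; last exact: ler_norm.
      have /andP[h1 h2] := bnd i.
      by move: (le_trans h1 h2); rewrite ler_pM2r// (lt_le_trans c0)// n0c.
    have [a [b [a0a ab bd sb]]] := IH _ (h_S Sx).
    have [nn d0] := pushP k _ (h_S Sx).
    have [[i di] _] := Hdel x _ Sx nn d0.
    have del01 : 0 < del <= 1 by rewrite del0 ltW.
    have [a' [b' [aa' ab' bb' e sb']]] :=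
      doeblin_step del01 ab (W_ge0 Sx) nn.1 di sb.
    exists a', b'; split=> //; first exact: le_trans aa'.
    by rewrite e exprS -mulrA ler_wpM2l// subr_ge0 ltW.
  exists (`|b0 - a0| * (B / a0)) => k x Sx.
  have [a [b [a0a ab bd sb]]] := ratio k x Sx.
  have [nn d0] := pushP k x Sx.
  split; last first.
    apply: (@lt_le_trans _ _ (a * dot (push n0 k x) x)).
      by rewrite mulr_gt0// (lt_le_trans a00).
    rewrite -dotZl -subr_ge0 -dotBl; apply: dot_ge0 => [j|]; last exact: S_ge0.
    by rewrite !mxE subr_ge0; have /andP[] := sb j.
  apply: le_trans (unit_at_close Sx nn d0 a00 a0a ab sb) _.
  rewrite mulrAC; apply: ler_wpM2r; first by rewrite divr_ge0// ltW.
  by rewrite mulrC.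
pose s0 (_ : 'rV[R]_N) : 'rV[R]_N := const_mx 1.
have [K0 HK0] : exists K, forall k x, S x ->
    `|unit_at x (push s0 k x) - unit_at x (push n0 k x)| <= K * (1 - del) ^+ k /\
    0 < dot (push s0 k x) x.
  by apply: (close _ 1 1) => // x Sx j; rewrite mxE lexx.
have [K1 HK1] : exists K, forall k x, S x ->
    `|unit_at x (push s0 k.+1 x) - unit_at x (push n0 k x)| <= K * (1 - del) ^+ k.
  (* The coordinates of [push s0 1 x] are the column sums of [W x]. They are at most [N L], and at
     least [c / B] because the coordinates of [n0 x], at least [c], weight the same entries by
     factors at most [B]. *)
  have [|||K HK] := close (push s0 1) (c / B) (Num.max (c / B) (N%:R * L)).
  - by rewrite divr_gt0.
  - by rewrite le_max lexx.
  - move=> x Sx j; have [nn d1] := Hm _ (h_S Sx); have [nn0 _] := nn.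
    have e : push s0 1 x 0 j = \sum_i W x i j.
      by rewrite /= mxE; apply: eq_bigr => i _; rewrite mxE mul1r.
    apply/andP; split.
      rewrite ler_pdivrMr// e; apply: le_trans (n0c x Sx j) _.
      rewrite /n0 mxE big_distrl /=; apply: ler_sum => i _; rewrite mulrC.
      rewrite ler_wpM2l ?W_ge0//.
      by have := normal_le (h_S Sx) nn i; rewrite d1 mulr1.
    rewrite le_max; apply/orP; right.
    rewrite e mulr_natl -[X in _ *+ X](card_ord N) -sumr_const.
    by apply: ler_sum => i _; exact: HL.
  by exists K => k x Sx; rewrite -push_shift; have [] := HK k x Sx.
pose u (k : nat) (x : 'rV[R]_N) := unit_at x (push s0 k x).
have /choice[nu Hnu] : forall x, exists l : 'rV[R]_N, S x -> u^~ x @ \oo --> l /\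
    forall k, `|l - u k x| <= (K0 + K1) * (1 - del) ^+ k / del.
  move=> x; have [Sx|nSx] := pselect (S x); last by exists 0.
  have [|l [Hl1 Hl2]] := @geometric_limit R N (u^~ x) (K0 + K1) (1 - del) th.
    move=> k; rewrite -[X in `|X|](subrKA (unit_at x (push n0 k x))).
    apply: le_trans (ler_normD _ _) _.
    rewrite mulrDl addrC lerD//; last exact: HK1.
    by rewrite distrC; have [] := HK0 k x Sx.
  by exists l => _; split=> // k; have := Hl2 k; rewrite subKr.
have geo0 (C : R) : (fun k => C * (1 - del) ^+ k) @ \oo --> (0 : R).
  by apply: cvg_geometric; have /andP[? ?] := th; rewrite ger0_norm.
exists nu; split; last first.
  move=> x Sx; have [ul _] := Hnu x Sx.
  (* The normalised transports of [n0] have the same limit, which is therefore normal. *)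
  have nl : (fun k => unit_at x (push n0 k x)) @ \oo --> nu x.
    have d0 : (fun k => u k x - unit_at x (push n0 k x)) @ \oo --> (0 : 'rV[R]_N).
      apply/cvgrPdist_le => e e0; move/cvgrPdist_le: (geo0 K0) => /(_ e e0).
      apply: filterS => k; rewrite !sub0r !normrN => H.
      apply: le_trans (HK0 k x Sx).1 _; exact: le_trans (ler_norm _) H.
    rewrite -[nu x]subr0.
    rewrite (_ : (fun k => unit_at x (push n0 k x)) = (fun k => u k x) -
      (fun k => u k x - unit_at x (push n0 k x))); first exact: cvgB ul d0.
    by apply/funext => k; rewrite !fctE subKr.
  split.
    apply: pos_normal_cvg nl => k; have [nn d0] := pushP k x Sx.
    by apply: pos_normalZ => //; rewrite invr_ge0 ltW.
  have : dot (unit_at x (push n0 k x)) x @[k --> \oo] --> dot (nu x) x.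
    by apply: cvg_dot => //; exact: cvg_cst.
  under eq_fun => k do rewrite (dot_unit_at (pushP k x Sx).2).
  by move=> /cvg_lim <-//; rewrite lim_cst.
move=> x Sx; apply/cvgrPdist_le => e e0.
have e30 : 0 < e / 3 by rewrite divr_gt0.
(* The geometric bound does not depend on [y]: convergence is uniform, and continuity passes to the
   limit. *)
have [k Hk] : exists k, forall y, S y -> `|nu y - u k y| <= e / 3.
  move/cvgrPdist_le: (geo0 ((K0 + K1) / del)) => /(_ _ e30) [k _ /(_ k (leqnn k))].
  rewrite sub0r normrN => H; exists k => y Sy.
  apply: le_trans ((Hnu y Sy).2 k) _; rewrite mulrAC.
  exact: le_trans (ler_norm _) H.
have uk : u k y @[y --> within S (nbhs x)] --> u k x.
  have cp : push s0 k y @[y --> within S (nbhs x)] --> push s0 k x.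
    by apply: push_cont => // z Sz; exact: cvg_cst.
  apply: cvgZ => //; apply: cvgV; first by rewrite gt_eqF// (HK0 k x Sx).2.
  by apply: cvg_dot => //; exact: cvg_within.
move/cvgrPdist_le: uk => /(_ _ e30) uk.
have : \forall y \near within S (nbhs x), S y by exact: withinT.
move: uk; apply: filterS2 => y uk Sy.
rewrite -[X in `|X|](subrKA (u k x)) -[X in _ + X](subrKA (u k y)).
apply: le_trans (ler_normD _ _) _.
apply: le_trans (lerD (Hk x Sx) (ler_normD _ _)) _.
have := Hk y Sy; rewrite distrC; lra.
Qed.

End PositiveCocycle.

(** * Normal functionals of convex sets *)

Section NormalVectors.
Variables (R : realType) (N : nat).
Implicit Types (n x z w a : 'rV[R]_N) (G : set 'rV[R]_N).

Definition segment_convex G : Prop :=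
  forall z w (t : R), G z -> G w -> 0 <= t <= 1 -> G (z + t *: (w - z)).

Lemma convex_set_segment G : convex_set G -> segment_convex G.
Proof.
move=> cG z w t Gz Gw t01.
have /andP[t0 t1] := t01.
have := cG w z (Itv01 t0 t1) (mem_set Gw) (mem_set Gz).
rewrite inE; congr (G _); rewrite /conv /= /unstable.onem.
by rewrite scalerBl scale1r scalerBr addrCA.
Qed.

Lemma normal_pullback G (F : 'rV[R]_N -> 'rV[R]_N) a n :
  differentiable F a -> segment_convex G -> G a ->
  (forall z, G z -> G (F z)) -> (forall z, G z -> dot n z <= dot n (F a)) ->
  forall z, G z -> dot (n *m Dmx F a) z <= dot (n *m Dmx F a) a.
Proof.
move=> dF cG Ga GF nG z Gz.
rewrite -subr_le0 -dotBr dot_mulmx /Dmx trmxK -deriveEjacobian//.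
set v := z - a.
have DF : h^-1 *: (F (h *: v + a) - F a) @[h --> 0^'] --> 'D_v F a.
  exact: (diff_derivable (v := v) dF).
have : dot n (h^-1 *: (F (h *: v + a) - F a)) @[h --> (0 : R)^'+] -->
    dot n ('D_v F a).
  apply: cvg_dot; first exact: cvg_cst.
  move=> A /DF; rewrite !nbhs_simpl /= /at_right /dnbhs /within /=.
  by apply: filterS => t H t0; apply: H; rewrite gt_eqF.
move=> H; apply: (cvgr_to_le H).
near=> t.
have t0 : 0 < t by near: t; exact: nbhs_right_gt.
have t1 : t <= 1 by near: t; apply: nbhs_right_le.
rewrite dotZr pmulr_rle0 ?invr_gt0// dotBr subr_le0 addrC; apply/nG/GF/cG => //.
by rewrite ltW.
Unshelve. all: by end_near. Qed.

Lemma cluster_le (T : topologicalType) (F : set_system T) (f : T -> R)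
    (x : T) (c : R) :
  cluster F x -> {for x, continuous f} -> (\forall y \near F, f y <= c) ->
  f x <= c.
Proof.
move=> Fx cf fc; rewrite leNgt; apply/negP => cx.
have [y [/= y1 y2]] := Fx _ [set y | c < f y] fc (cvgr_gt _ cf _ cx).
by move: y1; rewrite leNgt y2.
Qed.

(** A first-order expansion in [y] with quadratic error, from
    [Num.max (u - y) 0 <= |Num.max u 0 - y|]. *)
Lemma sqr_pos_part_sub (u y : R) : Num.max (u - y) 0 ^+ 2 <=
  Num.max u 0 ^+ 2 - 2 * (Num.max u 0 * y) + y ^+ 2.
Proof.
rewrite [leRHS](_ : _ = (Num.max u 0 - y) ^+ 2); last by ring.
by case: (leP u 0) => h1; case: (leP (u - y) 0) => h2; nra.
Qed.

(** Separation by projection: [phi] is the squared Euclidean distance to the shifted orthant with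
    vertex [q = x + e (1, ..., 1)]. At a minimiser [pi] on [G] the vector [m] of positive parts of
    [q - pi] is the normal sought; it is nonzero since otherwise [pi] would exceed [x] in every
    coordinate. *)
Lemma approx_pos_normal G x (e : R) :
  compact G -> segment_convex G -> G x -> 0 < e ->
  (forall z, G z -> ~ forall i, x 0 i < z 0 i) ->
  exists n, [/\ forall i, 0 <= n 0 i, \sum_i n 0 i = 1 &
    forall z, G z -> dot n z <= dot n x + e].
Proof.
move=> cG sG Gx e0 nll.
pose q i := x 0 i + e.
pose phi z : R := \sum_i Num.max (q i - z 0 i) 0 ^+ 2.
have cphi : {within G, continuous phi}.
  apply: continuous_subspaceT.
  apply: continuous_big => [|i _ z]; first exact: add_continuous.
  have cm : (fun w : 'rV[R]_N => Num.max (q i - w 0 i) 0) w @[w --> z] -->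
      Num.max (q i - z 0 i) 0.
    have cq : {for z, continuous (fun w : 'rV[R]_N => q i - w 0 i)}.
      apply: (@cvgB _ _ _ (nbhs z)); [exact: cvg_cst|exact: coord_continuous].
    have c0 : {for z, continuous (fun w : 'rV[R]_N => 0 : R)}.
      exact: cst_continuous.
    exact: (continuous_max cq c0).
  exact: (cvgM cm cm).
have [pi piG min] := EVT_min_rV (ex_intro _ x Gx) cG cphi.
move: piG; rewrite inE => piG.
pose m i := Num.max (q i - pi 0 i) 0.
have m0 i : 0 <= m i by rewrite /m le_max lexx orbT.
have T0 : 0 < \sum_i m i.
  rewrite lt_neqAle sumr_ge0// andbT eq_sym; apply/eqP => T0.
  apply: (nll _ piG) => i; have := T0 => /eqP.
  rewrite psumr_eq0// => /allP /(_ i); rewrite mem_index_enum => /(_ isT) /eqP mi.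
  have : q i - pi 0 i <= m i by rewrite /m le_max lexx.
  by rewrite mi /q; lra.
set T := \sum_i m i in T0.
exists (\row_i (m i / T)); split.
- by move=> i; rewrite mxE divr_ge0// ltW.
- under eq_bigr do rewrite mxE.
  by rewrite -big_distrl /= divff// gt_eqF.
move=> z Gz.
have H1 : \sum_i m i * (z 0 i - pi 0 i) <= 0.
  pose v := z - pi.
  pose c := \sum_i (v 0 i) ^+ 2.
  (* Minimality of [pi] against the points of the segment from [pi] to [z]. *)
  have key t : 0 <= t <= 1 -> 2 * t * \sum_i m i * v 0 i <= t ^+ 2 * c.
    move=> t01; have := min _ (mem_set (sG _ _ _ piG Gz t01)).
    move=> h.
    have : phi (pi + t *: (z - pi)) <=
        phi pi - 2 * t * (\sum_i m i * v 0 i) + t ^+ 2 * c.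
      rewrite /phi /c !big_distrr -sumrB -big_split; apply: ler_sum => i _ /=.
      rewrite !mxE opprD addrA; apply: le_trans (sqr_pos_part_sub _ _) _.
      by rewrite -/(m i) le_eqVlt; apply/orP; left; apply/eqP; ring.
    lra.
  have c0 : 0 <= c by apply: sumr_ge0 => i _; exact: sqr_ge0.
  have -> : \sum_i m i * (z 0 i - pi 0 i) = \sum_i m i * v 0 i.
    by apply: eq_bigr => i _; rewrite !mxE.
  set d := \sum_i m i * v 0 i in key *; rewrite leNgt; apply/negP => d0.
  (* If [d > 0], this [t] satisfies [t * c < d], which contradicts [key]. *)
  pose t := Num.min 1 (d / (c + 1)).
  have c1 : 0 < c + 1 by lra.
  have t0 : 0 < t by rewrite lt_min ltr01 divr_gt0.
  have t1 : t <= 1 by rewrite ge_min lexx.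
  have td : t * (c + 1) <= d by rewrite -ler_pdivlMr// ge_min lexx orbT.
  have := key t; rewrite (ltW t0) t1 => /(_ isT); nra.
have H2 : 0 <= \sum_i m i * (q i - pi 0 i).
  apply: sumr_ge0 => i _; rewrite /m maxEle; case: ifPn => [|h]; first by rewrite mul0r.
  by rewrite -expr2 sqr_ge0.
have E w : dot (\row_i (m i / T)) w = (\sum_i m i * w 0 i) / T.
  by rewrite /dot big_distrl; apply: eq_bigr => i _; rewrite mxE mulrAC.
rewrite !E ler_pdivrMr// mulrDl divfK ?gt_eqF//.
suff : \sum_i m i * z 0 i <= \sum_i m i * q i.
  move=> /le_trans; apply; rewrite /T big_distrr -big_split /=.
  by apply: ler_sum => i _; rewrite /q mulrDr [e * _]mulrC.
rewrite -subr_ge0.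
move: H1 H2; under eq_bigr do rewrite mulrBr; rewrite sumrB.
under [in X in _ -> X -> _]eq_bigr do rewrite mulrBr; rewrite sumrB; lra.
Qed.

(** A cluster point, in the unit cube, of approximate normals with errors [1 / (k + 1)]. *)
Lemma exists_pos_normal G x : compact G -> segment_convex G -> G x ->
  (forall z, G z -> ~ forall i, x 0 i < z 0 i) ->
  exists n, pos_normal G x n /\ \sum_i n 0 i = 1.
Proof.
move=> cG sG Gx nll.
have /choice[u uP] : forall k : nat, exists n, [/\ forall i, 0 <= n 0 i,
    \sum_i n 0 i = 1 & forall z, G z -> dot n z <= dot n x + k.+1%:R^-1].
  by move=> k; apply: approx_pos_normal.
have [|n [nbox nu]] := @rV_compact R N (fun=> `[0, 1]%classic)
    (fun=> @segment_compact _ _ _) (u @ \oo) _.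
  exists 0%N => // k _ /= i; have [u0 u1 _] := uP k.
  rewrite in_itv/= u0 -u1 (bigD1 i)//= lerDl sumr_ge0// => j _; exact: u0.
have dle w (c : R) : (\forall k \near \oo, dot (u k) w <= c) -> dot n w <= c.
  move=> H; apply: (cluster_le (f := fun v => dot v w) nu) => //.
  exact: (@cvg_dot _ _ _ (nbhs n) _ id (fun=> w) n w cvg_id (cvg_cst _)).
(* Only upper bounds on pairings pass to the cluster point through [dle]; the coordinate sum is
   fixed by pairing with the constant vectors 1 and -1. *)
have dE w (b : R) : dot w (const_mx b) = b * \sum_i w 0 i.
  by rewrite /dot big_distrr /=; apply: eq_bigr => i _; rewrite mxE mulrC.
exists n; split; first split.
- by move=> i; have := nbox i; rewrite /= in_itv/= => /andP[].
- move=> z Gz; rewrite -subr_le0 -dotBr; apply/ler_addgt0Pl => e e0; rewrite addr0.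
  apply: dle; near=> k; rewrite dotBr lerBlDl.
  have [_ _ /(_ z Gz)] := uP k => /le_trans; apply; rewrite lerD2l.
  by apply: ltW; near: k; exact: (near_infty_natSinv_lt (PosNum e0)).
- apply/eqP; rewrite eq_le; apply/andP; split.
    have := dle (const_mx 1) 1; rewrite dE mul1r; apply.
    by apply: nearW => k; rewrite dE mul1r; have [_ -> _] := uP k.
  have := dle (const_mx (-1)) (-1); rewrite dE mulN1r lerN2; apply.
  by apply: nearW => k; rewrite dE mulN1r; have [_ -> _] := uP k.
Unshelve. all: by end_near. Qed.

End NormalVectors.

(** * Derivative matrices of smooth maps and of their inverses *)

Section SmoothMaps.
Variables (R : realType) (N : nat).
Implicit Types (U : set 'rV[R]_N) (f g : 'rV[R]_N -> 'rV[R]_N) (x : 'rV[R]_N).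

Lemma Dmx_derive f x i j : differentiable f x ->
  Dmx f x i j = 'D_(delta_mx 0 j) f x 0 i.
Proof. by move=> df; rewrite deriveEjacobian// -rowE !mxE. Qed.

Lemma Dmx_continuous U f x i j : open U -> Ck_on 2 U f -> U x ->
  {for x, continuous (fun z => Dmx f z i j)}.
Proof.
move=> oU [df ddf] Ux; have [/(_ x Ux) dD _] := ddf (delta_mx 0 j).
have cD := differentiable_continuous dD.
have : 'D_(delta_mx 0 j) f z 0 i @[z --> x] --> 'D_(delta_mx 0 j) f x 0 i.
  exact: (coord_cvg (i := i) cD).
have e : {near x, (fun z => 'D_(delta_mx 0 j) f z 0 i) =1
                  (fun z => Dmx f z i j)}.
  apply: filterS (open_nbhs_nbhs (conj oU Ux)) => z Uz.
  exact: esym (Dmx_derive i j (df z Uz)).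
move=> H; apply: cvg_trans (near_eq_cvg e) _.
exact: (eq_ind_r (fun l => _ --> l) H (Dmx_derive i j (df x Ux))).
Qed.

(** Differentiating [g \o f = id] near [x] gives a one-sided inverse, which suffices for square
    matrices. *)
Lemma invmx_Dmx U f g x : open U -> U x -> differentiable f x ->
  differentiable g (f x) -> (forall y, U y -> g (f y) = y) ->
  invmx (Dmx f x) = Dmx g (f x).
Proof.
move=> oU Ux df dg gK.
have e (v : 'rV[R]_N) : v *m jacobian f x *m jacobian g (f x) = v.
  have dgf : differentiable (g \o f) x by exact: differentiable_comp.
  rewrite -(deriveEjacobian v df) -(deriveEjacobian ('D_v f x) dg).
  rewrite (deriveE v df) (deriveE _ dg).
  have E := congr1 (fun F : 'rV[R]_N -> 'rV[R]_N => F v) (diff_comp df dg).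
  apply: (etrans (esym E)); apply: (etrans (esym (deriveE v dgf))).
  apply: (etrans _ (derive_id x v)); apply: near_eq_derive.
  by apply: filterS (open_nbhs_nbhs (conj oU Ux)) => y Uy; exact: gK.
have e1 : jacobian f x *m jacobian g (f x) = 1%:M.
  by apply/row_matrixP => i; rewrite rowE mulmxA e row1.
have e2 : Dmx g (f x) *m Dmx f x = 1%:M by rewrite -trmx_mul e1 trmx1.
have [_ uf] := mulmx1_unit e2.
by rewrite -[LHS]mul1mx -e2 mulmxK.
Qed.

End SmoothMaps.

(** * From a field of normals to the radial function *)

Section RadialGraph.
Variables (R : realType) (N : nat) (S : set 'rV[R]_N).
Implicit Types x y z n : 'rV[R]_N.
Hypothesis S_sub : S `<=` orthant `\ 0.
Hypothesis S_homeo : homeomorphism_between (@radial R N) S simplex.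

Lemma coord_sum_ge0 x : orthant x -> 0 <= \sum_i x 0 i.
Proof. by move=> x0; apply: sumr_ge0. Qed.

Lemma coord_le_sum x i : orthant x -> x 0 i <= \sum_i x 0 i.
Proof. by move=> x0; rewrite (bigD1 i)//= lerDl sumr_ge0. Qed.

Lemma coord_sum_gt0 x : orthant x -> x <> 0 -> 0 < \sum_i x 0 i.
Proof.
move=> x0 xn0; rewrite lt_neqAle coord_sum_ge0// andbT eq_sym.
apply/eqP => s0; apply: xn0; apply/rowP => i; rewrite mxE.
by apply/eqP; rewrite eq_le x0 andbT -s0 coord_le_sum.
Qed.

Lemma partial_orthant0 x : partial_orthant 0 x <-> orthant x /\ 0 < \sum_i x 0 i.
Proof.
split=> [[[i xi] x0]|[x0 s0]].
  have xo : orthant x by move=> j; exact: x0.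
  by split=> //; exact: lt_le_trans xi (coord_le_sum _ xo).
have [i xi] := exists_large_summand s0; split; last by move=> j _; exact: x0.
exists i; have := lt_le_trans s0 xi.
by rewrite pmulr_rgt0// ltr0n (leq_ltn_trans _ (ltn_ord i)).
Qed.

Lemma radial_simplex x : partial_orthant 0 x -> simplex (radial x).
Proof.
move=> /partial_orthant0[x0 s0]; split.
  by move=> i; rewrite mxE mulr_ge0// invr_ge0 ltW.
by under eq_bigr do rewrite mxE; rewrite -big_distrr /= mulVf// gt_eqF.
Qed.

Lemma radial_cont : cont_on (partial_orthant 0) (@radial R N).
Proof.
move=> x /partial_orthant0[x0 s0]; apply: cvgZ; last exact: cvg_within.
apply: cvgV; first by rewrite gt_eqF.
apply: cvg_big => [|i _]; first exact: add_continuous.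
by apply: coord_cvg; exact: cvg_within.
Qed.

Lemma radial_section : exists s : 'rV[R]_N -> 'rV[R]_N,
  [/\ cont_on simplex s, forall y, simplex y -> S (s y),
      forall y, simplex y -> radial (s y) = y &
      forall x, S x -> s (radial x) = x].
Proof.
have [[rS rI rO] _ [s [cs sK]]] := S_homeo.
exists s; split.
- exact/cont_on_within.
- by move=> y /rO[x Sx <-]; rewrite sK// inE.
- by move=> y /rO[x Sx <-]; rewrite sK// inE.
- by move=> x Sx; rewrite sK// inE.
Qed.

Lemma simplex_partial_orthant y : simplex y -> partial_orthant 0 y.
Proof. by move=> [y0 y1]; apply/partial_orthant0; rewrite y1. Qed.

Lemma radial_id y : simplex y -> radial y = y.
Proof. by move=> [_ y1]; rewrite /radial y1 invr1 scale1r. Qed.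

Lemma radialK x : orthant x -> 0 < \sum_i x 0 i ->
  (\sum_i x 0 i) *: radial x = x.
Proof. by move=> x0 s0; rewrite scalerA mulfV ?gt_eqF// scale1r. Qed.

Lemma sub_radial_hull x : S x -> radial_hull S x.
Proof. by move=> Sx; exists 1, x; rewrite scale1r. Qed.

(** The point of [S] over a vertex of the simplex. Testing a normal on it bounds the [i]-th
    coordinate of that normal. *)
Lemma axis_point i : exists2 c, 0 < c & S (c *: delta_mx 0 i).
Proof.
have [s [_ sS rs _]] := radial_section.
have di : simplex (delta_mx 0 i : 'rV[R]_N).
  split; first by move=> j; rewrite mxE ler0n.
  rewrite (bigD1 i)//= mxE !eqxx big1 ?addr0// => j ji.
  by rewrite mxE (negPf ji) andbF.
have Ss := sS _ di; have [so sn0] := S_sub Ss.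
exists (\sum_j s (delta_mx 0 i) 0 j); first exact: coord_sum_gt0.
rewrite -[X in _ *: X](rs _ di) radialK//; exact: coord_sum_gt0.
Qed.

(* Convexity alone gives the Whitney condition for the gauge p = <nu, ->:
   0 <= p z - p x - <nu x, z - x> <= <nu z - nu x, z - x>. *)
Lemma C1_of_normal_section (nu : 'rV[R]_N -> 'rV[R]_N) :
  cont_on S nu ->
  (forall x, S x -> pos_normal (radial_hull S) x (nu x) /\ dot (nu x) x = 1) ->
  exists rho : 'rV[R]_N -> R,
    [/\ Ck_up_to_boundary 1 simplex rho,
        forall y, simplex y -> 0 < rho y &
        forall y, simplex y ->
          S `&` (@radial R N @^-1` [set y]) = [set rho y *: y]].
Proof.
move=> nu_cont nuP.
have [s [s_cont sS rs sr]] := radial_section.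
(* [sg x] is the point of [S] on the ray through [x], so [mu] is constant on rays. *)
pose sg x := s (radial x).
pose mu x := nu (sg x).
pose p x := dot (mu x) x.
have sgS x : partial_orthant 0 x -> S (sg x) by move=> x0; exact/sS/radial_simplex.
have mu_cont : cont_on (partial_orthant 0) mu.
  have c1 := cont_on_comp radial_simplex radial_cont s_cont.
  exact: (cont_on_comp sgS c1 nu_cont).
have sgE x : partial_orthant 0 x -> exists2 l, 0 < l & x = l *: sg x.
  move=> x0; have Ss := sgS x x0; have [so sn0] := S_sub Ss.
  have /partial_orthant0[xo xs] := x0.
  have s0 := coord_sum_gt0 so sn0.
  exists ((\sum_i x 0 i) / (\sum_i sg x 0 i)); first exact: divr_gt0.
  have e : (\sum_i sg x 0 i) *: radial x = sg x.
    by rewrite -{1}(rs _ (radial_simplex x0)); exact: radialK.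
  rewrite -[X in _ *: X]e scalerA divfK ?gt_eqF//.
  exact: esym (radialK xo xs).
(* The gauge is the maximum of the functionals [mu z]: on [S] each is at most 1 by normality, and
   both sides are homogeneous in [x]. *)
have le_mu x z : partial_orthant 0 x -> partial_orthant 0 z ->
    dot (mu z) x <= dot (mu x) x.
  move=> x0 z0; have [l l0 xE] := sgE x x0.
  rewrite {1 3}xE !dotZr ler_wpM2l ?(ltW l0)//.
  have [[_ nz] dz] := nuP _ (sgS _ z0); have [_ dx] := nuP _ (sgS _ x0).
  by rewrite /mu dx -dz; apply: nz; exact/sub_radial_hull/sgS.
have pC1 : c1_within (partial_orthant 0) p mu.
  move=> x x0 e e0.
  (* The factor [N] comes from [norm_dot_le]; with 1 added, one bound controls both the remainder
     and the variation of [mu]. *)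
  have N1 : 0 < N%:R + 1 :> R by rewrite ltr_wpDl.
  have d0 : 0 < e / (N%:R + 1) by exact: divr_gt0.
  have /cvgrPdist_lt /(_ _ d0) := mu_cont x x0.
  rewrite /within /= => /nbhs_ballP[r /= r0 H].
  exists r => // z z0 zx.
  have {}H : `|mu x - mu z| < e / (N%:R + 1).
    by apply: H => //; rewrite -ball_normE /= distrC.
  rewrite distrC in H.
  have H' : (N%:R + 1) * `|mu z - mu x| <= e by rewrite mulrC -ler_pdivlMr// ltW.
  split; last by apply: le_trans H'; rewrite ler_peMl// lerDr.
  have h1 := le_mu x z x0 z0; have h2 := le_mu z x z0 x0.
  have h3 := norm_dot_le (mu z - mu x) (z - x).
  have h4 : N%:R * (`|mu z - mu x| * `|z - x|) <= e * `|z - x|.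
    rewrite mulrA ler_wpM2r//; apply: le_trans H'.
    by rewrite ler_wpM2r// lerDl.
  have := le_trans (ler_norm _) (le_trans h3 h4).
  rewrite dotBl !dotBr ler_norml /p; move: h1 h2; lra.
have [f [phi [fC1 fp]]] := c1_within_extension pC1.
pose A : set 'rV[R]_N := partial_orthant N.
have oA : open A.
  have -> : A = \bigcup_(i in [set: 'I_N]) [set x | 0 < x 0 i].
    apply/seteqP; split=> [x [[i xi] _]|x [i _ xi]]; first by exists i.
    by split; [exists i|move=> j; rewrite leqNgt ltn_ord].
  apply: bigcup_open => i _.
  apply: (@open_comp _ _ (fun x : 'rV[R]_N => x 0 i) [set t | 0 < t]).
    by move=> x _; exact: coord_continuous.
  exact: open_gt.
pose B := A `&` [set x | 0 < f x].
have fA := c1_within_Ck_on oA fC1.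
have oB : open B.
  rewrite openE => x [Ax fx].
  have cf : {for x, continuous f} by apply: differentiable_continuous; exact: fA.1.
  apply: filterI; first exact: open_nbhs_nbhs (conj oA Ax).
  exact: (cvgr_gt _ cf _ fx).
have fB : Ck_on 1 B f by split=> [x [/fA.1]//|v x [/(fA.2 v)]].
have pS y : simplex y -> p y = (\sum_i s y 0 i)^-1 /\ 0 < \sum_i s y 0 i.
  move=> sy; have Ss := sS _ sy; have [so sn0] := S_sub Ss.
  have s0 := coord_sum_gt0 so sn0; split=> //.
  rewrite /p /mu /sg (radial_id sy).
  by rewrite -{2}(rs y sy) /radial dotZr (nuP _ Ss).2 mulr1.
exists (fun x => (f x)^-1); split.
- exists B, (fun x => (f x)^-1); split; [exact: oB| | |by []].
  + move=> y sy; have y0 := simplex_partial_orthant sy; split.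
      by have [[i yi] _] := y0; split; [exists i|move=> j; rewrite leqNgt ltn_ord].
    have [py s0] := pS _ sy; rewrite /= fp// py invr_gt0//.
  + by apply: Ck_on1_inv => // x [_ /= fx]; rewrite gt_eqF.
- move=> y sy; have [py s0] := pS _ sy.
  by rewrite fp ?py ?invrK//; exact: simplex_partial_orthant.
move=> y sy; have [py s0] := pS _ sy.
rewrite fp ?py ?invrK; last exact: simplex_partial_orthant.
have Ss := sS _ sy; have [so _] := S_sub Ss.
have e : (\sum_i s y 0 i) *: y = s y by rewrite -{2}(rs y sy) radialK.
rewrite e; apply/seteqP; split=> [x [Sx /= xy]|x /= ->]; first by rewrite -xy sr.
by split=> //=; exact: rs.
Qed.

End RadialGraph.

(** * The carrying simplex *)

Section CarryingSimplexNormals.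
Variables (R : realType) (N : nat) (S : set 'rV[R]_N).
Variables (g : 'rV[R]_N -> 'rV[R]_N) (M : 'rV[R]_N -> 'M[R]_N).
Implicit Types x y z n : 'rV[R]_N.
Local Notation G := (radial_hull S).
Hypothesis S_sub : S `<=` orthant `\ 0.
Hypothesis S_homeo : homeomorphism_between (@radial R N) S simplex.
Hypotheses (S_compact : compact S) (G_compact : compact G).
Hypothesis G_convex : segment_convex G.
Hypothesis S_unordered : forall x y, S x -> S y -> ~ forall i, x 0 i < y 0 i.
Hypotheses (g_S : forall x, S x -> S (g x)) (g_cont : cont_on S g).
Hypothesis g_supp : forall x, S x -> forall i, (0 < g x 0 i) = (0 < x 0 i).
Hypothesis M_cont : forall i j, cont_on S (fun x => M x i j).
Hypothesis M_ge0 : forall x, S x -> forall i j, 0 <= M x i j.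
Hypothesis M_gt0 : forall x, S x -> forall i j,
  0 < x 0 i -> 0 < x 0 j -> 0 < M x i j.
Hypothesis M_col : forall x, S x -> forall j,
  exists2 l, 0 < x 0 l & 0 < M x l j.
Hypothesis M_normal : forall x n, S x -> pos_normal G (g x) n ->
  pos_normal G x (n *m M x).

Lemma dot_delta n (c : R) i : dot n (c *: delta_mx 0 i) = c * n 0 i.
Proof.
rewrite dotZr /dot (bigD1 i)//= mxE !eqxx mulr1 big1 ?addr0// => j ji.
by rewrite mxE (negPf ji) andbF mulr0.
Qed.

Lemma S_ge0 x : S x -> forall i, 0 <= x 0 i.
Proof. by move=> /S_sub[]. Qed.

(** A point [a *: y] of [G] strictly above [x] would put [y] strictly above [x] within [S]. The
    normal obtained has a positive coordinate, and the axis point of that index makes [dot n x]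
    positive. *)
Lemma pos_normal_ex x : S x -> exists2 n, pos_normal G x n & 0 < dot n x.
Proof.
move=> Sx; have [] := @exists_pos_normal _ _ G x G_compact G_convex.
- exact: sub_radial_hull.
- move=> z [a [y [a0 a1 Sy ->]]] xz; apply: (S_unordered Sx Sy) => i.
  apply: lt_le_trans (xz i) _; rewrite mxE ler_piMl//; exact: S_ge0.
move=> n [nn n1]; exists n => //; have [n0 nG] := nn.
have [i ni] : exists i, 0 < n 0 i.
  have [i h] : exists i, \sum_i n 0 i <= N%:R * n 0 i.
    by apply: exists_large_summand; rewrite n1.
  exists i; have : 0 < N%:R * n 0 i by apply: lt_le_trans h; rewrite n1.
  by rewrite pmulr_rgt0// ltr0n (leq_ltn_trans _ (ltn_ord i)).
have [c c0 Sc] := axis_point S_sub S_homeo i.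
have := nG _ (sub_radial_hull Sc); rewrite dot_delta.
by apply: lt_le_trans; exact: mulr_gt0.
Qed.

Lemma pos_normal_bound : exists2 B, 0 < B &
  forall x n, pos_normal G x n -> forall i, n 0 i <= B * dot n x.
Proof.
have [||k k0 H] := @finite_uniform_pos R 'I_N
  (fun i k => forall x n, pos_normal G x n -> n 0 i * k <= dot n x).
- move=> i; have [c c0 Sc] := axis_point S_sub S_homeo i; exists c => // x n [_ nG].
  by have := nG _ (sub_radial_hull Sc); rewrite dot_delta mulrC.
- move=> i k k' kk H x n nn; apply: le_trans (H x n nn).
  by rewrite ler_wpM2l// nn.1.
exists k^-1; first by rewrite invr_gt0.
by move=> x n nn i; rewrite mulrC ler_pdivlMr//; exact: H.
Qed.

(** Two steps are taken at once: for [i] in the support and any column [j], [M_col] supplies an [l]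
    in the support with [M x l j] positive, and the entry [i, l] of [M (g x)] is positive as
    well. *)
Lemma carrying_simplex_normal_section : exists nu : 'rV[R]_N -> 'rV[R]_N,
  cont_on S nu /\ forall x, S x -> pos_normal G x (nu x) /\ dot (nu x) x = 1.
Proof.
have [B B0 HB] := pos_normal_bound.
apply: (@continuous_normal_section R N S G (g \o g)
  (fun x => M (g x) *m M x) B).
- exact: S_compact.
- exact: S_ge0.
- by move=> x Sx; exact/g_S/g_S.
- exact: (cont_on_comp g_S g_cont g_cont).
- move=> i j x Sx; rewrite mxE; under eq_fun do rewrite mxE.
  apply: cvg_big => [|l _]; first exact: add_continuous.
  apply: cvgM; last exact: M_cont.
  exact: (cont_on_comp g_S g_cont (M_cont (i := i) (j := l))).
- move=> x Sx i j; rewrite mxE sumr_ge0// => l _.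
  by rewrite mulr_ge0 ?M_ge0//; exact: g_S.
- move=> x Sx i j /=; rewrite g_supp; last exact: g_S.
  rewrite g_supp// => xi; have [l xl Mlj] := M_col Sx j.
  rewrite mxE (bigD1 l)//= ltr_pwDl//.
    by rewrite mulr_gt0// M_gt0 ?g_supp//; exact: g_S.
  by rewrite sumr_ge0// => k _; rewrite mulr_ge0 ?M_ge0//; exact: g_S.
- move=> x n Sx nn; rewrite mulmxA; apply: (M_normal Sx).
  exact: M_normal (g_S Sx) nn.
- exact: B0.
- by move=> x n _; exact: HB.
- exact: pos_normal_ex.
Qed.

End CarryingSimplexNormals.

(** * Supports of points and their invariance under [P] *)

Section Supports.
Variables (R : realType) (N : nat) (P : 'rV[R]_N -> 'rV[R]_N).
Implicit Types x y : 'rV[R]_N.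

Definition supp x : {set 'I_N} := [set i | 0 < x 0 i]%SET.

Lemma in_supp x i : (i \in supp x) = (0 < x 0 i).
Proof. by rewrite inE. Qed.

Lemma face_int_supp x : orthant x -> face_int (supp x) x.
Proof.
move=> x0; split; first split=> // j; last by move=> i; rewrite in_supp.
by rewrite in_supp -leNgt => h; apply/eqP; rewrite eq_le h x0.
Qed.

Lemma supp_neq0 x : orthant x -> x <> 0 -> supp x != finset.set0.
Proof.
move=> x0 xn0; apply/eqP => s0; apply: xn0; apply/rowP => i; rewrite mxE.
apply/eqP; rewrite eq_le x0 andbT leNgt -in_supp s0 inE.
by [].
Qed.

Lemma supp_image x i : faces_preserved P -> orthant x -> x <> 0 ->
  (0 < P x 0 i) = (0 < x 0 i).
Proof.
move=> H2 x0 xn0.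
have [+ _] := H2 _ (supp_neq0 x0 xn0) (face_int (supp x))
  (or_intror (or_introl erefl)).
move=> /(_ (P x)) [|[_ Pz] Pp]; first by exists x => //; exact: face_int_supp.
have [xi|xi] := ltP 0 (x 0 i); first by rewrite Pp// in_supp.
by rewrite Pz ?ltxx// in_supp -leNgt.
Qed.

End Supports.

(** * The inverse of [P] as a positive cocycle over the carrying simplex *)

Theorem mainTheorem1 (R : realType) (N : nat) (P : 'rV[R]_N -> 'rV[R]_N)
    (U : set 'rV[R]_N) (Pt : 'rV[R]_N -> 'rV[R]_N) (S : set 'rV[R]_N)
    (N_ge2 : (2 <= N)%N)
    (H1 : Ck_diffeo_extension 2 orthant P U Pt)
    (H2 : faces_preserved P)
    (H3' : inverse_positive Pt)
    (H4' : axial_fixed_points P Pt)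
    (H5 : periodic_eigenvalue_lt1 P Pt)
    (H6 : ratio_condition P)
    (hS : carrying_simplex P S)
    (S_convex : convex_set (radial_hull S)) :
  exists rho : 'rV[R]_N -> R,
    [/\ Ck_up_to_boundary 1 simplex rho,
        forall y, simplex y -> 0 < rho y &
        forall y, simplex y ->
          S `&` (@radial R N @^-1` [set y]) = [set rho y *: y]].
Proof.
have [orthU [oU oV PtC [g [gC gK]]] PPt] := H1.
have [S_compact S_sub S_inv S_homeo S_unord _ _ [G_compact G_sub G_inv _]] := hS.
have G_convex := convex_set_segment S_convex.
set V := Pt @` U in oV gC.
have gPt x : U x -> g (Pt x) = x by move=> Ux; rewrite gK// inE.
have PE x : orthant x -> P x = Pt x by move=> x0; rewrite PPt// inE.
have gP x : orthant x -> g (P x) = x.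
  by move=> x0; rewrite PE// gPt//; exact: orthU.
have PV x : orthant x -> V (P x).
  by move=> x0; rewrite PE//; exists x => //; exact: orthU.
(* Invariance gives [x] a preimage in [S], and [g] recovers it. *)
have S_pre x : S x -> S (g x) /\ P (g x) = x.
  rewrite -{1}S_inv => -[y Sy <-]; have [y0 _] := S_sub _ Sy.
  by rewrite gP.
have G_pre x : radial_hull S x -> radial_hull S (g x).
  by rewrite -{1}G_inv => -[y Gy <-]; rewrite gP//; exact: G_sub.
have S_V x : S x -> V x.
  move=> Sx; have [Sg <-] := S_pre x Sx; apply: PV.
  by have [] := S_sub _ Sg.
have g_diff x : V x -> differentiable g x := gC.1 x.
have [Dg [Dg_cont Dg_inv Dg_pull]] : exists Dg : 'rV[R]_N -> 'M[R]_N,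
  [/\ forall i j x, V x -> {for x, continuous (fun z => Dg z i j)},
      forall x, orthant x -> invmx (Dmx Pt x) = Dg (P x) &
      forall x n, S x -> (forall z, radial_hull S z -> dot n z <= dot n (g x)) ->
        forall z, radial_hull S z -> dot (n *m Dg x) z <= dot (n *m Dg x) x].
  exists (Dmx g); split.
  - by move=> i j x; exact: Dmx_continuous oV gC.
  - move=> x x0; have Ux := orthU _ x0.
    have dg : differentiable g (Pt x) by rewrite -PE//; exact/g_diff/PV.
    rewrite (PE _ x0); exact: (invmx_Dmx oU Ux (PtC.1 x Ux) dg gPt).
  - move=> x n Sx; exact: (normal_pullback (g_diff _ (S_V _ Sx)) G_convex
      (sub_radial_hull Sx) G_pre).
have Sg x : S x -> [/\ orthant (g x), g x <> 0, P (g x) = x &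
    invmx (Dmx Pt (g x)) = Dg x].
  move=> Sx; have [Sgx Pgx] := S_pre x Sx; have [go gn0] := S_sub _ Sgx.
  by split; [exact: go|exact: gn0|exact: Pgx|rewrite (Dg_inv _ go) Pgx].
have g_supp x : S x -> forall i, (0 < g x 0 i) = (0 < x 0 i).
  move=> Sx i; have [go gn0 Pgx _] := Sg x Sx.
  by rewrite -[in RHS]Pgx; rewrite (supp_image i H2 go gn0).
have M_ge0 x : S x -> forall i j, 0 <= Dg x i j.
  move=> Sx i j; have [go gn0 Pgx _] := Sg x Sx; have Ugx := orthU _ go.
  (* (H3') with the full index set gives positive entries at interior points only. The point [g x]
     is approached along the diagonal direction from the interior, and the sign passes to the
     limit. *)
  pose y (t : R) := g x + t *: const_mx 1.
  have y_cvg : y t @[t --> 0^'+] --> g x.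
    apply: rV_cvg => k.
    have H : g x 0 k + t @[t --> 0^'+] --> g x 0 k + 0.
      by apply: cvgD; [exact: cvg_cst|exact: cvg_within].
    rewrite addr0 in H.
    suff -> : (fun t => y t 0 k) = (fun t => g x 0 k + t) by exact: H.
    by apply/funext => t; rewrite !mxE mulr1.
  have Pc : Pt (y t) @[t --> 0^'+] --> x.
    have := cvg_comp y Pt y_cvg (differentiable_continuous (PtC.1 _ Ugx)).
    by rewrite -PE// Pgx.
  have : Dg (Pt (y t)) i j @[t --> 0^'+] --> Dg x i j.
    exact: (cvg_comp (fun t => Pt (y t)) (fun z => Dg z i j) Pc
      (Dg_cont i j x (S_V x Sx))).
  move/cvgr_to_ge; apply; near=> t.
  have t0 : 0 < t by near: t; exact: nbhs_right_gt.
  have yo k : 0 < y t 0 k by rewrite !mxE mulr1 ltr_wpDl.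
  have yo' : orthant (y t) by move=> k; exact: ltW.
  rewrite -PE// -Dg_inv//.
  have T0 : [set: 'I_N]%SET != finset.set0 by apply/set0Pn; exists i; rewrite inE.
  have fy : face_int [set: 'I_N]%SET (y t).
    by split=> [|k _]; [split=> // k; rewrite inE|exact: yo].
  have [+ _] := H3' _ T0 _ fy.
  by move=> /(_ i j); rewrite !inE => /(_ isT isT)/ltW.
have face_g x : S x -> face_int (supp (g x)) (g x) /\ supp (g x) != finset.set0.
  move=> Sx; have [go gn0 _ _] := Sg x Sx.
  by split; [exact: face_int_supp|exact: supp_neq0].
have M_gt0 x : S x -> forall i j, 0 < x 0 i -> 0 < x 0 j -> 0 < Dg x i j.
  move=> Sx i j xi xj; have [_ _ _ e] := Sg x Sx; have [fg s0] := face_g x Sx.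
  have [+ _] := H3' _ s0 _ fg; rewrite e; apply; by rewrite in_supp g_supp.
have M_col x : S x -> forall j, exists2 l, 0 < x 0 l & 0 < Dg x l j.
  move=> Sx j; have [xj|xj] := ltP 0 (x 0 j).
    by exists j => //; exact: M_gt0.
  have [_ _ _ e] := Sg x Sx; have [fg s0] := face_g x Sx.
  (* Off the support, the second half of (H3') is applied to the [j]-th basis vector, which lies in
     the complementary face. *)
  have [_ /(_ (delta_mx 0 j))] := H3' _ s0 _ fg; rewrite e => -[||l].
  - split; first by move=> k; rewrite mxE ler0n.
    move=> k; rewrite mxE eqxx /= finset.in_setC negbK in_supp g_supp// => xk.
    by case: eqP => // kj; move: xj; rewrite -kj leNgt xk.
  - by apply/eqP => /rowP/(_ j); rewrite !mxE !eqxx => /eqP; rewrite oner_eq0.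
  rewrite in_supp g_supp// => xl; rewrite trmx_delta -colE mxE => Ml.
  by exists l.
have g_cont : cont_on S g.
  move=> x Sx; apply: continuous_cont_on; apply: differentiable_continuous.
  exact/g_diff/S_V.
have M_cont i j : cont_on S (fun x => Dg x i j).
  by move=> x Sx; apply: continuous_cont_on; exact/Dg_cont/S_V.
have M_normal x n : S x -> pos_normal (radial_hull S) (g x) n ->
    pos_normal (radial_hull S) x (n *m Dg x).
  move=> Sx [n0 nG]; split.
    by move=> j; rewrite mxE sumr_ge0// => i _; rewrite mulr_ge0 ?M_ge0.
  exact: Dg_pull.
have [||nu [nu_cont nuP]] := @carrying_simplex_normal_section R N S g Dg
  S_sub S_homeo S_compact G_compact G_convex _ _ g_cont g_supp M_cont M_ge0 M_gt0
  M_col M_normal.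
- by move=> x y Sx Sy xy; apply: (S_unord x y Sx Sy) => i _; exact: xy.
- by move=> x Sx; have [] := S_pre x Sx.
exact: (C1_of_normal_section S_sub S_homeo nu_cont nuP).
Unshelve. all: by end_near.
Qed.
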